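(* Let $A\in C_b^1([0,\infty),\mathbb{R}^{d,d})$, i.e., $A(\cdot)$ and $\dot A(\cdot)$ are continuous and bounded. Then there exist constants $C,h_0>0$ such that $$d_H\big(\Sigma_s^{\mathrm{step}}(h),\Sigma_s^{\mathrm{cont}}\big)\le C h\qquad\text{for all } 0<h\le h_0,$$ where $d_H$ denotes the Hausdorff distance.
   Context: $\mathcal{G}(s,d)$, $s\in\{1,\dots,d\}$, is the set of $s$-dimensional subspaces of $\mathbb{R}^d$. For $V,W\in\mathcal{G}(s,d)$, $\measuredangle(V,W)\in[0,\frac{\pi}{2}]$ is the maximal principal angle: $\measuredangle(V,W)=\arccos(\sigma_s)$, where $\sigma_1\ge\dots\ge\sigma_s\ge0$ are the singular values of $V_B^\top W_B$ and the columns of $V_B,W_B\in\mathbb{R}^{d,s}$ are orthonormal bases of $V,W$. $P_V$ is the orthogonal projector onto $V$ and $\|\cdot\|$ is the spectral norm; $\mathrm{cl}$ denotes closure in $\mathbb{R}$. $\Phi(t,\tau)$ denotes the solution operator of the linear system $\dot u(t)=A(t)u(t)$, $t\ge0$. For $T>0$ and $V\in\mathcal{G}(s,d)$, $$\alpha_s^{\mathrm{cont}}(T,V)=\frac1T\int_0^T\big\|(I_d-P_{\Phi(t,0)V})A(t)P_{\Phi(t,0)V}\big\|\,dt,$$ $$\alpha_s^{\mathrm{step}}(h,T,V)=\frac1T\sum_{j=1}^{N}\measuredangle\big(\Phi((j-1)h,0)V,\ \Phi(jh,0)V\big),\qquad h=\frac TN,\ N\in\mathbb{N}.$$ The angular ranges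 are $$I_s^{\mathrm{cont}}(V)=\Big[\varliminf_{T\to\infty}\alpha_s^{\mathrm{cont}}(T,V),\ \varlimsup_{T\to\infty}\alpha_s^{\mathrm{cont}}(T,V)\Big],\quad I_s^{\mathrm{step}}(h,V)=\Big[\varliminf_{N\to\infty}\alpha_s^{\mathrm{step}}(h,Nh,V),\ \varlimsup_{N\to\infty}\alpha_s^{\mathrm{step}}(h,Nh,V)\Big],$$ and the angular spectra are $$\Sigma_s^{\mathrm{cont}}=\mathrm{cl}\Big[\bigcup_{V\in\mathcal{G}(s,d)}I_s^{\mathrm{cont}}(V)\Big],\qquad \Sigma_s^{\mathrm{step}}(h)=\mathrm{cl}\Big[\bigcup_{V\in\mathcal{G}(s,d)}I_s^{\mathrm{step}}(h,V)\Big].$$ *)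

(* Defs.v *)
From HB Require Import structures.
From mathcomp Require Import all_boot all_order all_algebra.
From mathcomp Require Import all_classical all_reals all_analysis.
From mathcomp Require Import polyrcf.

Set Implicit Arguments.
Unset Strict Implicit.
Unset Printing Implicit Defensive.

Import Order.TTheory GRing.Theory Num.Theory.
Import numFieldNormedType.Exports.

Local Open Scope classical_set_scope.
Local Open Scope ring_scope.

Definition halfline (R : realType) : set R := `[0, +oo[%classic.
Arguments halfline : clear implicits.

(* The derivative is taken within [0, +oo[, hence one-sided at t = 0. *)
Definition is_derive_halfline (R : realType) (m n : nat)
    (F : R -> 'M[R]_(m, n)) (t : R) (D : 'M[R]_(m, n)) : Prop :=
  (fun u : R => (u - t)^-1 *: (F u - F t)) @ within (halfline R) t^' --> D.

Definition bounded_continuous_halfline (R : realType) (m n : nat)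
    (F : R -> 'M[R]_(m, n)) : Prop :=
  {within halfline R, continuous F} /\ [bounded F t | t in halfline R].

Definition C1b (R : realType) (m n : nat) (F : R -> 'M[R]_(m, n)) : Prop :=
  exists F' : R -> 'M[R]_(m, n),
    [/\ forall t : R, 0 <= t -> is_derive_halfline F t (F' t),
        bounded_continuous_halfline F & bounded_continuous_halfline F'].

Definition solution_operator (R : realType) (d : nat)
    (A : R -> 'M[R]_d) (Phi : R -> R -> 'M[R]_d) : Prop :=
  forall tau : R, 0 <= tau ->
    Phi tau tau = 1%:M /\
    forall t : R, 0 <= t ->
      is_derive_halfline (fun u => Phi u tau) t (A t *m Phi t tau).

Definition euclidean_norm (R : realType) (n : nat) (x : 'cV[R]_n) : R :=
  Num.sqrt (\sum_(i < n) x i 0 ^+ 2).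

(* The library norm `|M| on matrices is the maximum of the entries. *)
Definition spectral_norm (R : realType) (m n : nat) (M : 'M[R]_(m, n)) : R :=
  sup [set euclidean_norm (M *m x) | x in
        [set x : 'cV[R]_n | euclidean_norm x <= 1]].

(* In decreasing order, repeated according to the multiplicity of the
   corresponding eigenvalue of M^T M. *)
Definition singular_values (R : realType) (n : nat) (M : 'M[R]_n) : seq R :=
  let p := char_poly (M^T *m M) in
  sort >=%R [seq Num.sqrt x | x <- flatten [seq nseq (mup x p) x | x <- rootsR p]].

Definition Grassmannian (R : realType) (s d : nat) : set {vspace 'cV[R]_d} :=
  [set V | \dim V = s].
Arguments Grassmannian : clear implicits.

Definition image_subspace (R : realType) (d : nat)
    (M : 'M[R]_d) (V : {vspace 'cV[R]_d}) : {vspace 'cV[R]_d} :=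
  (linfun (mulmx M : 'cV[R]_d -> 'cV[R]_d) @: V)%VS.

Definition is_orthonormal_basis (R : realType) (s d : nat)
    (V : {vspace 'cV[R]_d}) (B : 'M[R]_(d, s)) : Prop :=
  B^T *m B = 1%:M /\ <<[seq col j B | j <- enum 'I_s]>>%VS = V.

Definition orthonormal_basis (R : realType) (s d : nat)
    (V : {vspace 'cV[R]_d}) : 'M[R]_(d, s) :=
  xget 0 [set B | is_orthonormal_basis V B].
Arguments orthonormal_basis {R} s {d} V.

(* Meaningful for V and W of dimension s; the indices of the singular values
   are shifted by one, as sequences are numbered from 0. *)
Definition max_principal_angle (R : realType) (s d : nat)
    (V W : {vspace 'cV[R]_d}) : R :=
  acos (nth 0 (singular_values
          ((orthonormal_basis s V)^T *m orthonormal_basis s W)) s.-1).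
Arguments max_principal_angle {R} s {d} V W.

Definition is_orthogonal_projector (R : realType) (d : nat)
    (V : {vspace 'cV[R]_d}) (P : 'M[R]_d) : Prop :=
  forall x : 'cV[R]_d, P *m x \in V /\
    forall y : 'cV[R]_d, y \in V -> y^T *m (x - P *m x) = 0.

Definition orthogonal_projector (R : realType) (d : nat)
    (V : {vspace 'cV[R]_d}) : 'M[R]_d :=
  xget 0 [set P | is_orthogonal_projector V P].

Definition alpha_cont (R : realType) (d : nat) (A : R -> 'M[R]_d)
    (Phi : R -> R -> 'M[R]_d) (T : R) (V : {vspace 'cV[R]_d}) : R :=
  T^-1 * \int[lebesgue_measure]_(t in `[0, T])
    let P := orthogonal_projector (image_subspace (Phi t 0) V) in
    spectral_norm ((1%:M - P) *m A t *m P).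

(* The argument T = N h is represented by N. *)
Definition alpha_step (R : realType) (s d : nat)
    (Phi : R -> R -> 'M[R]_d) (h : R) (N : nat) (V : {vspace 'cV[R]_d}) : R :=
  (N%:R * h)^-1 * \sum_(1 <= j < N.+1)
    max_principal_angle s (image_subspace (Phi (j.-1%:R * h) 0) V)
                          (image_subspace (Phi (j%:R * h) 0) V).

Definition I_cont (R : realType) (d : nat) (A : R -> 'M[R]_d)
    (Phi : R -> R -> 'M[R]_d) (V : {vspace 'cV[R]_d}) : set R :=
  let a (T : R) : \bar R := (alpha_cont A Phi T V)%:E in
  [set x : R | (limf_einf a (pinfty_nbhs R) <= x%:E)%E /\
               (x%:E <= limf_esup a (pinfty_nbhs R))%E].

Definition I_step (R : realType) (s d : nat)
    (Phi : R -> R -> 'M[R]_d) (h : R) (V : {vspace 'cV[R]_d}) : set R :=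
  let a (N : nat) : \bar R := (alpha_step s Phi h N V)%:E in
  [set x : R | (limn_einf a <= x%:E)%E /\ (x%:E <= limn_esup a)%E].

Definition Sigma_cont (R : realType) (s d : nat) (A : R -> 'M[R]_d)
    (Phi : R -> R -> 'M[R]_d) : set R :=
  closure (\bigcup_(V in Grassmannian R s d) I_cont A Phi V).

Definition Sigma_step (R : realType) (s d : nat)
    (Phi : R -> R -> 'M[R]_d) (h : R) : set R :=
  closure (\bigcup_(V in Grassmannian R s d) I_step s Phi h V).

Definition hausdorff_dist (R : realType) (X Y : set R) : \bar R :=
  maxe (ereal_sup [set edist_inf Y x | x in X])
       (ereal_sup [set edist_inf X y | y in Y]).

(* Main.v *)
Require Import Defs.
From HB Require Import structures.
From mathcomp Require Import all_boot all_order all_algebra.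
From mathcomp Require Import all_classical all_reals all_analysis.
From mathcomp Require Import complex polyrcf.
From mathcomp Require Import ring lra.

Set Implicit Arguments.
Unset Strict Implicit.
Unset Printing Implicit Defensive.

Import Order.TTheory GRing.Theory Num.Theory.
Import numFieldNormedType.Exports.

Local Open Scope classical_set_scope.
Local Open Scope ring_scope.

(** The two spectra are close because the averages defining them are close,
    uniformly in the subspace.  Write [V t] for the image of [V] under the flow
    at time [t] and [f t] for the norm of [(1 - P) A P], where [P] is the
    projector onto [V t]; [f] is the integrand of the continuous average.

    The local estimate is that the maximal principal angle between [V t] and
    [V (t + h)] equals [h * f t] up to [O(h ^ 2)] ([angle_step]).  The sine of
    this angle is the largest distance to [V t] of a unit vector of [V (t + h)]
    ([max_principal_angleP]); a vector of [V (t + h)] is an explicit Euler step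
    [v + h A v] from some [v] of [V t] up to [O(h ^ 2)] ([flow_partnerP]), and the
    part of it orthogonal to [V t] is [h (1 - P) A v]; finally an angle and its
    sine agree to second order.  Identifying the cosine of the angle, given by the
    last entry of a sorted list of roots of a characteristic polynomial, with a
    minimal length takes the spectral theorem for real symmetric matrices
    ([symmetric_spectral], [smallest_singular_value]).

    The projectors along the flow are Lipschitz in time ([proj_step]), hence so is
    [f], and the integral of [f] over a step is [h * f t] up to [O(h ^ 2)].
    Summing [N] steps and dividing by [N h] leaves a difference of [O(h)] between
    the two averages at the times [N h] ([alpha_step_cont]); between grid times
    the continuous average moves by [O(1/T)] only ([alpha_step_truncn]).  So the
    lower and upper limits differ by [O(h)], each point of one angular range has a
    point of the other within [O(h)] ([limit_range_close]), and this passes to the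
    union over all [V] and to closures ([hausdorff_closure_le]).

    All constants depend only on a number [L] bounding [A] and its Lipschitz
    constant, and the step is restricted to [8 L h <= 1]. *)

(** * Scalar product, Euclidean norm and spectral norm *)

Section Euclidean.
Variable R : realType.

Definition dot (n : nat) (x y : 'cV[R]_n) : R := (x^T *m y) 0 0.

Lemma dotE n (x y : 'cV[R]_n) : dot x y = \sum_i x i 0 * y i 0.
Proof. by rewrite /dot !mxE; apply: eq_bigr => i _; rewrite !mxE. Qed.

Lemma dotC n (x y : 'cV[R]_n) : dot x y = dot y x.
Proof. by rewrite !dotE; apply: eq_bigr => i _; rewrite mulrC. Qed.

Lemma dotDr n (x y z : 'cV[R]_n) : dot x (y + z) = dot x y + dot x z.
Proof. by rewrite /dot mulmxDr mxE. Qed.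

Lemma dotDl n (x y z : 'cV[R]_n) : dot (x + y) z = dot x z + dot y z.
Proof. by rewrite dotC dotDr !(dotC z). Qed.

Lemma dotZr n a (x y : 'cV[R]_n) : dot x (a *: y) = a * dot x y.
Proof. by rewrite /dot -scalemxAr mxE. Qed.

Lemma dotZl n a (x y : 'cV[R]_n) : dot (a *: x) y = a * dot x y.
Proof. by rewrite dotC dotZr dotC. Qed.

Lemma dotNr n (x y : 'cV[R]_n) : dot x (- y) = - dot x y.
Proof. by rewrite -scaleN1r dotZr mulN1r. Qed.

Lemma dotNl n (x y : 'cV[R]_n) : dot (- x) y = - dot x y.
Proof. by rewrite dotC dotNr dotC. Qed.

Lemma dot_mull m n (M : 'M[R]_(m, n)) x y : dot (M *m x) y = dot x (M^T *m y).
Proof. by rewrite /dot trmx_mul mulmxA. Qed.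

Lemma dot_ge0 n (x : 'cV[R]_n) : 0 <= dot x x.
Proof. by rewrite dotE sumr_ge0// => i _; rewrite -expr2 sqr_ge0. Qed.

Local Notation norm := (@euclidean_norm R _).

Lemma normE n (x : 'cV[R]_n) : norm x = Num.sqrt (dot x x).
Proof. by rewrite /euclidean_norm dotE; congr Num.sqrt; apply: eq_bigr. Qed.

Lemma norm_ge0 n (x : 'cV[R]_n) : 0 <= norm x.
Proof. by rewrite sqrtr_ge0. Qed.
Hint Resolve norm_ge0 : core.

Lemma sqr_norm n (x : 'cV[R]_n) : norm x ^+ 2 = dot x x.
Proof. by rewrite normE sqr_sqrtr// dot_ge0. Qed.

Lemma norm_eq0 n (x : 'cV[R]_n) : (norm x == 0) = (x == 0).
Proof.
apply/eqP/eqP => [nx0|->]; last first.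
  by rewrite normE /dot mulmx0 mxE sqrtr0.
have /eqP : dot x x = 0 by rewrite -sqr_norm nx0 expr0n.
rewrite dotE psumr_eq0 => [/allP x0|i _]; last by rewrite -expr2 sqr_ge0.
apply/colP => i; rewrite mxE.
have /(_ _)/implyP/(_ isT) := x0 i.
by rewrite mem_index_enum mulf_eq0 orbb => /(_ isT)/eqP.
Qed.

Lemma norm0 n : norm (0 : 'cV[R]_n) = 0.
Proof. by apply/eqP; rewrite norm_eq0. Qed.

Lemma normZ n a (x : 'cV[R]_n) : norm (a *: x) = `|a| * norm x.
Proof.
by rewrite !normE dotZr dotZl mulrA -expr2 sqrtrM ?sqr_ge0// sqrtr_sqr.
Qed.

Lemma normN n (x : 'cV[R]_n) : norm (- x) = norm x.
Proof. by rewrite -scaleN1r normZ normrN1 mul1r. Qed.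

Lemma cauchy_schwarz n (x y : 'cV[R]_n) : dot x y <= norm x * norm y.
Proof.
have [->|y0] := eqVneq y 0.
  by rewrite norm0 mulr0 /dot mulmx0 mxE.
have [->|x0] := eqVneq x 0.
  by rewrite norm0 mul0r dotC /dot mulmx0 mxE.
have xp : 0 < norm x by rewrite lt0r norm_eq0 x0 norm_ge0.
have yp : 0 < norm y by rewrite lt0r norm_eq0 y0 norm_ge0.
have := dot_ge0 (norm y *: x - norm x *: y).
rewrite !(dotDl, dotDr, dotNr, dotNl, dotZr, dotZl) -!sqr_norm (dotC y x).
rewrite [X in 0 <= X](_ : _ = 2 * (norm x * norm y) *
  (norm x * norm y - dot x y)); last by ring.
by rewrite pmulr_rge0 ?mulr_gt0// subr_ge0.
Qed.

Lemma abs_dot_le n (x y : 'cV[R]_n) : `|dot x y| <= norm x * norm y.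
Proof.
rewrite ler_norml cauchy_schwarz andbT lerNl -dotNl -[norm x]normN.
exact: cauchy_schwarz.
Qed.

Lemma normD n (x y : 'cV[R]_n) : norm (x + y) <= norm x + norm y.
Proof.
rewrite -ler_sqr ?nnegrE ?addr_ge0//.
rewrite sqr_norm !(dotDl, dotDr) (dotC y x) sqrrD !sqr_norm.
by have := cauchy_schwarz x y; lra.
Qed.

Lemma normB n (x y : 'cV[R]_n) : norm (x - y) <= norm x + norm y.
Proof. by rewrite (le_trans (normD _ _))// normN. Qed.

Lemma norm_dist_le n (x y : 'cV[R]_n) : `|norm x - norm y| <= norm (x - y).
Proof.
rewrite ler_norml; apply/andP; split.
  by have := normB x (x - y); rewrite subKr; lra.
by have := normD (x - y) y; rewrite subrK; lra.
Qed.

(** With [x] itself as the test vector, mean value estimates for scalar functions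
    become estimates for vector-valued ones. *)
Lemma norm_le_dot n (x : 'cV[R]_n) (c : R) :
  0 <= c -> dot x x <= c * norm x -> norm x <= c.
Proof.
move=> c0; rewrite -sqr_norm expr2.
have [->|x0] := eqVneq x 0; first by rewrite norm0.
by rewrite ler_pM2r// lt0r norm_eq0 x0 norm_ge0.
Qed.

Lemma entry_le_norm n (x : 'cV[R]_n) i : `|x i 0| <= norm x.
Proof.
rewrite -sqrtr_sqr /euclidean_norm ler_wsqrtr// (bigD1 i)//= lerDl.
by rewrite sumr_ge0// => j _; rewrite sqr_ge0.
Qed.

Lemma norm_le_sum n (x : 'cV[R]_n) : norm x <= \sum_i `|x i 0|.
Proof.
apply: norm_le_dot; first by rewrite sumr_ge0.
rewrite dotE mulr_suml ler_sum// => i _.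
rewrite (le_trans (ler_norm _))// normrM ler_wpM2l// entry_le_norm//.
Qed.

Lemma norm_mulmx_le_entries m n (M : 'M[R]_(m, n)) (c : R) x :
  (forall i j, `|M i j| <= c) -> norm (M *m x) <= (m * n)%:R * c * norm x.
Proof.
move=> Mc; rewrite (le_trans (norm_le_sum _))//.
rewrite (@le_trans _ _ (\sum_(i < m) \sum_(j < n) c * norm x))//.
  apply: ler_sum => i _; rewrite mxE (le_trans (ler_norm_sum _ _ _))//.
  apply: ler_sum => j _; rewrite normrM ler_pM// entry_le_norm//.
by rewrite !sumr_const !card_ord -mulrnA -[leLHS]mulr_natl mulnC mulrA.
Qed.

Local Notation snorm := (@spectral_norm R _ _).

Lemma spectral_norm_has_sup m n (M : 'M[R]_(m, n)) :
  has_sup [set norm (M *m x) | x in [set x : 'cV[R]_n | norm x <= 1]].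
Proof.
split; first by exists (norm (M *m 0)), 0; rewrite //= norm0.
pose c := \sum_i \sum_j `|M i j|.
have cM i j : `|M i j| <= c.
  rewrite /c (bigD1 i)//= (bigD1 j)//= -addrA lerDl addr_ge0// ?sumr_ge0//.
  by move=> k _; rewrite sumr_ge0.
exists ((m * n)%:R * c) => _ [x /= x1 <-].
rewrite (le_trans (norm_mulmx_le_entries x cM))// ler_piMr//.
by rewrite mulr_ge0// sumr_ge0// => i _; rewrite sumr_ge0.
Qed.

Lemma spectral_norm_ge0 m n (M : 'M[R]_(m, n)) : 0 <= snorm M.
Proof.
have [_ ub] := spectral_norm_has_sup M.
by apply: (ub_le_sup ub); exists 0; rewrite /= ?mulmx0 norm0.
Qed.

Lemma norm_mulmx_le m n (M : 'M[R]_(m, n)) x : norm (M *m x) <= snorm M * norm x.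
Proof.
have [->|x0] := eqVneq x 0; first by rewrite mulmx0 !norm0 mulr0.
have xp : 0 < norm x by rewrite lt0r norm_eq0 x0 norm_ge0.
rewrite -ler_pdivrMr//; have [_ ub] := spectral_norm_has_sup M.
apply: (ub_le_sup ub); exists ((norm x)^-1 *: x) => /=.
  by rewrite normZ ger0_norm ?invr_ge0// mulVf ?gt_eqF.
by rewrite -scalemxAr normZ ger0_norm ?invr_ge0// mulrC.
Qed.

Lemma spectral_norm_le m n (M : 'M[R]_(m, n)) c :
  (forall x, norm x <= 1 -> norm (M *m x) <= c) -> snorm M <= c.
Proof.
move=> Mc; have [ne _] := spectral_norm_has_sup M.
by apply: ge_sup => // _ [x /= x1 <-]; exact: Mc.
Qed.

End Euclidean.

#[global] Hint Extern 0 (is_true (0 <= euclidean_norm _)) =>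
  exact: norm_ge0 : core.

(** * Orthonormal bases and orthogonal projectors *)

Section Projectors.
Variable R : realType.
Local Notation norm := (@euclidean_norm R _).
Implicit Types (d s : nat).

Lemma memv_colspanP d s (B : 'M[R]_(d, s)) (y : 'cV[R]_d) :
  y \in <<[seq col j B | j <- enum 'I_s]>>%VS <-> exists x, y = B *m x.
Proof.
split=> [|[x ->]]; last first.
  rewrite (_ : B *m x = \sum_j x j 0 *: col j B).
    apply: memv_suml => j _; apply/memvZ/memv_span/map_f.
    by rewrite mem_enum.
  apply/colP => i; rewrite mxE summxE; apply: eq_bigr => j _.
  by rewrite !mxE mulrC.
rewrite span_def big_map big_enum /= => /memv_sumP[v vP ->].
have /choice[c cE] : forall j, exists k, v j = k *: col j B.
  by move=> j; have /vlineP := vP j isT.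
exists (\col_j c j); apply/colP => i; rewrite mxE summxE.
by apply: eq_bigr => j _; rewrite cE !mxE mulrC.
Qed.

Lemma dot_colmul d s (B : 'M[R]_(d, s)) x y :
  B^T *m B = 1%:M -> dot (B *m x) (B *m y) = dot x y.
Proof. by move=> B1; rewrite dot_mull mulmxA B1 mul1mx. Qed.

Lemma norm_colmul d s (B : 'M[R]_(d, s)) x :
  B^T *m B = 1%:M -> norm (B *m x) = norm x.
Proof. by move=> B1; rewrite !normE dot_colmul. Qed.

Lemma dim_orthonormal_span d s (B : 'M[R]_(d, s)) :
  B^T *m B = 1%:M -> \dim <<[seq col j B | j <- enum 'I_s]>>%VS = s.
Proof.
move=> B1; set X := map _ _.
have szX : size X = s by rewrite size_map size_enum_ord.
suff fX : free X by rewrite -[RHS]szX; apply/eqP; exact: fX.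
have -> : X = [tuple col j B | j < s] by [].
apply/freeP => k k0 j.
have : B *m (\col_j k j) = 0.
  rewrite -[RHS]k0; apply/colP => i; rewrite mxE summxE.
  apply: eq_bigr => l _.
  by rewrite (nth_map j) ?size_enum_ord// nth_ord_enum !mxE mulrC.
move/(congr1 (mulmx B^T)); rewrite mulmxA B1 mul1mx mulmx0.
by move/colP/(_ j); rewrite !mxE.
Qed.

(** As long as there are fewer than [s] columns, their span misses a vector of
    [V], whose component orthogonal to them can be normalised and appended. *)
Lemma orthonormal_basis_exists d s (V : {vspace 'cV[R]_d}) :
  \dim V = s -> exists B : 'M[R]_(d, s), is_orthonormal_basis V B.
Proof.
move=> dV.
suff H n : (n <= s)%N -> exists B : 'M[R]_(d, n),
    B^T *m B = 1%:M /\ forall x, B *m x \in V.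
  have [B [B1 BV]] := H s (leqnn s); exists B; split=> //.
  apply/eqP; rewrite eqEdim (dim_orthonormal_span B1) dV leqnn andbT.
  by apply/subvP => y /memv_colspanP[x ->].
elim: n => [_|n IH ns].
  exists 0; split; first by apply/matrixP => -[].
  by move=> x; rewrite mul0mx mem0v.
have [B [B1 BV]] := IH (ltnW ns).
have /subvPn[v vV vB] : ~~ (V <= <<[seq col j B | j <- enum 'I_n]>>)%VS.
  apply/negP => /dimvS; rewrite dV (dim_orthonormal_span B1).
  by rewrite leqNgt ns.
pose w := v - B *m (B^T *m v).
have w0 : w != 0.
  rewrite subr_eq0; apply/eqP => vE; move/negP: vB; apply.
  by apply/memv_colspanP; exists (B^T *m v).
have wp : 0 < norm w by rewrite lt0r norm_eq0 w0 norm_ge0.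
have wV : w \in V by rewrite memvB.
have Bw : B^T *m w = 0 by rewrite mulmxBr (mulmxA B^T B) B1 mul1mx subrr.
pose u := (norm w)^-1 *: w.
have uu : u^T *m u = 1%:M.
  apply/matrixP => i j; rewrite !ord1 -/(dot u u) dotZr dotZl -sqr_norm !mxE/=.
  by field; rewrite gt_eqF.
have Bu : B^T *m u = 0 by rewrite -scalemxAr Bw scaler0.
have uB : u^T *m B = 0 by apply: trmx_inj; rewrite trmx_mul trmxK Bu trmx0.
(* Blocks live in dimension n + 1, which is not n.+1 by computation. *)
suff [B' [B'1 B'V]] : exists B' : 'M[R]_(d, n + 1),
    B'^T *m B' = 1%:M /\ forall x, B' *m x \in V.
  by move: (n + 1)%N (addn1 n) B' B'1 B'V => m -> B' B'1 B'V; exists B'.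
exists (row_mx B u); split=> [|x].
  by rewrite tr_row_mx mul_col_row B1 Bu uB uu -scalar_mx_block.
rewrite -[x]vsubmxK mul_row_col memvD// (mx11_scalar (dsubmx x)).
by rewrite mul_mx_scalar memvZ// memvZ.
Qed.

Lemma orthonormal_basisP d s (V : {vspace 'cV[R]_d}) :
  \dim V = s -> is_orthonormal_basis V (orthonormal_basis s V).
Proof.
move=> /orthonormal_basis_exists[B BV].
by apply: (@xgetPex _ 0 [set B | is_orthonormal_basis V B]); exists B.
Qed.

Local Notation proj := (@orthogonal_projector R _).

Lemma basis_projector d s (V : {vspace 'cV[R]_d}) (B : 'M[R]_(d, s)) :
  is_orthonormal_basis V B -> is_orthogonal_projector V (B *m B^T).
Proof.
move=> [B1 <-] x; split=> [|y /memv_colspanP[z ->]].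
  by apply/memv_colspanP; exists (B^T *m x); rewrite mulmxA.
have E : B^T *m (x - B *m B^T *m x) = 0.
  by rewrite mulmxBr -(mulmxA B) (mulmxA B^T B) B1 mul1mx subrr.
by rewrite trmx_mul -(mulmxA z^T) E mulmx0.
Qed.

Lemma orthogonal_projectorP d (V : {vspace 'cV[R]_d}) :
  is_orthogonal_projector V (proj V).
Proof.
have [B BV] := orthonormal_basis_exists (erefl (\dim V)).
apply: (@xgetPex _ 0 [set P | is_orthogonal_projector V P]).
by exists (B *m B^T); exact: basis_projector.
Qed.

Lemma mem_proj d (V : {vspace 'cV[R]_d}) x : proj V *m x \in V.
Proof. by case: (orthogonal_projectorP V x). Qed.

Lemma dot_proj_compl d (V : {vspace 'cV[R]_d}) x y :
  y \in V -> dot y ((1%:M - proj V) *m x) = 0.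
Proof.
move=> yV; have [_ /(_ _ yV)] := orthogonal_projectorP V x.
by rewrite /dot mulmxBl mul1mx => ->; rewrite mxE.
Qed.

Lemma pythagoras d (V : {vspace 'cV[R]_d}) x :
  norm x ^+ 2 = norm (proj V *m x) ^+ 2 + norm ((1%:M - proj V) *m x) ^+ 2.
Proof.
set u := proj V *m x; set v := _ *m x.
have -> : x = u + v by rewrite /v mulmxBl mul1mx addrC subrK.
rewrite !sqr_norm dotDl !dotDr (dotC v u).
by rewrite (dot_proj_compl x (mem_proj V x)) addr0 add0r.
Qed.

Lemma norm_proj_le d (V : {vspace 'cV[R]_d}) x : norm (proj V *m x) <= norm x.
Proof.
by rewrite -ler_sqr ?nnegrE// (pythagoras V x) lerDl sqr_ge0.
Qed.

Lemma norm_compl_le d (V : {vspace 'cV[R]_d}) x :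
  norm ((1%:M - proj V) *m x) <= norm x.
Proof.
by rewrite -ler_sqr ?nnegrE// (pythagoras V x) lerDr sqr_ge0.
Qed.

Lemma proj_id d (V : {vspace 'cV[R]_d}) x : x \in V -> proj V *m x = x.
Proof.
move=> xV; apply/eqP; rewrite eq_sym -subr_eq0 -norm_eq0 -sqrf_eq0 sqr_norm.
have := dot_proj_compl x (memvB xV (mem_proj V x)).
by rewrite mulmxBl mul1mx => ->.
Qed.

Lemma compl_id d (V : {vspace 'cV[R]_d}) x : x \in V -> (1%:M - proj V) *m x = 0.
Proof. by move=> xV; rewrite mulmxBl mul1mx proj_id// subrr. Qed.

Lemma proj_selfadjoint d (V : {vspace 'cV[R]_d}) x y :
  dot (proj V *m x) y = dot x (proj V *m y).
Proof.
have E z t : dot (proj V *m z) t = dot (proj V *m z) (proj V *m t).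
  have := dot_proj_compl t (mem_proj V z).
  rewrite mulmxBl mul1mx dotDr dotNr => /eqP.
  by rewrite subr_eq0 => /eqP.
by rewrite E [RHS]dotC [RHS]E [RHS]dotC.
Qed.

Lemma compl_selfadjoint d (V : {vspace 'cV[R]_d}) x y :
  dot ((1%:M - proj V) *m x) y = dot x ((1%:M - proj V) *m y).
Proof.
by rewrite !mulmxBl !mul1mx dotDl dotDr dotNl dotNr proj_selfadjoint.
Qed.

Lemma projectorE d s (V : {vspace 'cV[R]_d}) (B : 'M[R]_(d, s)) :
  is_orthonormal_basis V B -> proj V = B *m B^T.
Proof.
move=> VB; apply/eqP; rewrite -subr_eq0; apply/eqP.
suff E (x : 'cV_d) : (proj V - B *m B^T) *m x = 0.
  apply/matrixP => i j; have /colP/(_ i) := E (delta_mx j 0).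
  by rewrite -colE !mxE.
have [BV Bo] := basis_projector VB x.
set u := B *m B^T *m x in BV Bo.
have uV : proj V *m x - u \in V by rewrite memvB// mem_proj.
apply/eqP; rewrite mulmxBl -/u -norm_eq0 -sqrf_eq0 sqr_norm.
have := dot_proj_compl x uV.
have := congr1 (fun M : 'M[R]_(1, 1) => M 0 0) (Bo _ uV).
rewrite -/(dot _ _) mulmxBl mul1mx [X in _ = X -> _]mxE.
rewrite !(dotDr, dotNr) => h1 h2.
by apply/eqP; lra.
Qed.

End Projectors.

(** * Spectral theorem and smallest singular value *)

Section SymmetricSpectrum.
Variable R : realType.
Local Notation norm := (@euclidean_norm R _).
Local Notation C := R[i].
Local Notation f := (real_complex R).

Local Open Scope sesquilinear_scope.

Lemma complex_quadratic_form n (U : 'M[C]_n) (r : 'I_n -> R) (x : 'cV[R]_n) :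
  ((map_mx f x)^T *m (U ^t* *m diag_mx (\row_i f (r i)) *m U) *m map_mx f x) 0 0
  = f (\sum_i r i * (complex.Re `|(U *m map_mx f x) i 0|) ^+ 2).
Proof.
have -> : (map_mx f x)^T = (map_mx f x)^t*.
  by apply/matrixP => i j; rewrite !mxE conj_Creal//; apply/complex_realP; exists (x j i).
set X := map_mx f x; set y := U *m X.
rewrite !mulmxA -mulmxA -/y.
have -> : X ^t* *m U ^t* = y ^t* by rewrite -map_mxM -trmx_mul.
rewrite mxE rmorph_sum; apply: eq_bigr => i _.
rewrite mul_mx_diag !mxE rmorphM rmorphXn; set z : C := \sum_j _.
have E : f (complex.Re `|z|) = `|z| by rewrite RRe_real ?normr_real.
rewrite [X in _ = _ * X ^+ 2]E.
by rewrite normCK [z * _]mulrC mulrA -mulrA mulrCA mulrA.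
Qed.

(** Read off from the unitary diagonalisation over the complex numbers, where the
    eigenvalues of a Hermitian matrix are real: [w i] is the squared length of the
    component of [x] in the [i]-th eigendirection. *)
Lemma symmetric_spectral n (N : 'M[R]_n) : N^T = N ->
  exists r : 'I_n -> R, char_poly N = \prod_i ('X - (r i)%:P) /\
    forall x : 'cV[R]_n, exists w : 'I_n -> R,
      [/\ forall i, 0 <= w i, dot x x = \sum_i w i
        & dot x (N *m x) = \sum_i r i * w i].
Proof.
move=> Nsym; pose A := map_mx f N.
have Aherm : A \is hermsymmx.
  apply: realsym_hermsym; last first.
    by apply/mxOverP => i j; rewrite mxE; apply/complex_realP; exists (N i j).
  by apply/is_hermitianmxP; rewrite expr0 scale1r map_mx_id// /A map_trmx Nsym.
set U := spectralmx A; set D := spectral_diag A.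
have Dreal := hermitian_spectral_diag_real Aherm.
have AE : A = invmx U *m diag_mx D *m U.
  exact/orthomx_spectralP/hermitian_normalmx.
have UU : U \is unitarymx := spectral_unitarymx A.
pose r i := complex.Re (D 0 i).
have DE : D = \row_i f (r i).
  apply/rowP => i; rewrite !mxE RRe_real//.
  by move/mxOverP: Dreal; apply.
exists r; split.
  apply: (map_poly_inj f); rewrite map_char_poly -/A rmorph_prod/=.
  have -> : char_poly A = char_poly (diag_mx D).
    rewrite /char_poly/char_poly_mx AE.
    have Uu : map_mx polyC U \in unitmx by rewrite map_unitmx// spectral_unit.
    have -> : 'X%:M - map_mx polyC (invmx U *m diag_mx D *m U) =
      invmx (map_mx polyC U) *m ('X%:M - map_mx polyC (diag_mx D))
        *m map_mx polyC U.
      rewrite !map_mxM map_invmx mulmxBr mulmxBl -!mulmxA.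
      by rewrite -scalar_mxC mulKmx.
    rewrite !det_mulmx mulrAC -det_mulmx mulVmx// det1 mul1r//.
  rewrite char_poly_trig ?diag_mx_is_trig//.
  apply: eq_bigr => i _; rewrite !mxE eqxx mulr1n DE mxE.
  by rewrite rmorphB/= map_polyX map_polyC.
move=> x; exists (fun i => (complex.Re `|(U *m map_mx f x) i 0|) ^+ 2); split.
- by move=> i; rewrite sqr_ge0.
- apply: (@complexI R); have := complex_quadratic_form U (fun=> 1) x.
  have -> : (\row_(i < n) f 1 : 'rV[C]_n) = const_mx 1 by apply/rowP => i; rewrite !mxE.
  rewrite diag_const_mx mulmx1 -invmx_unitary// mulVmx ?spectral_unit// mulmx1.
  under [in RHS]eq_bigr do rewrite mul1r.
  by move<-; rewrite map_trmx -map_mxM mxE.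
- apply: (@complexI R); have := complex_quadratic_form U r x.
  by rewrite -DE -invmx_unitary// -AE => <-; rewrite map_trmx -!map_mxM mxE /dot mulmxA.
Qed.

End SymmetricSpectrum.

Section SmallestSingularValue.
Variable R : realType.
Local Notation norm := (@euclidean_norm R _).

Lemma count_flatten_nseq (T : eqType) (m : T -> nat) (s : seq T) x : uniq s ->
  count_mem x (flatten [seq nseq (m y) y | y <- s]) = ((x \in s) * m x)%N.
Proof.
elim: s => [|y s IH]//= /andP[ys us].
rewrite count_cat count_nseq IH// in_cons [x == y]eq_sym/=.
by have [<-|] := eqVneq y x; rewrite ?(negbTE ys) ?mul1n ?mul0n ?addn0.
Qed.

(** Over a split polynomial, listing the real roots with their multiplicities
    loses nothing; so a singular value list has full length, and its last entry
    is not a default value. *)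
Lemma perm_roots_with_multiplicity (s : seq R)
    (p := \prod_(x <- s) ('X - x%:P)) :
  perm_eq (flatten [seq nseq (mup x p) x | x <- rootsR p]) s.
Proof.
have p0 : p != 0.
  by rewrite prodf_seq_neq0; apply/allP => i _; rewrite polyXsubC_eq0.
rewrite /perm_eq; apply/allP => x _ /=.
rewrite count_flatten_nseq; last exact: uniq_roots.
rewrite -(roots_on_rootsR p0) in_itv/=.
have [px|px] := boolP (root p x).
  by rewrite mul1n mu_prod_XsubC.
by rewrite mul0n -(mu_prod_XsubC x s) mupNroot.
Qed.

(** The squared length of [M x] is the quadratic form of [M^T M], which the
    spectral theorem bounds below by the smallest eigenvalue, with equality at an
    eigenvector. *)
Lemma smallest_singular_value n (M : 'M[R]_n)
    (sigma := nth 0 (singular_values M) n.-1) : (0 < n)%N ->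
  [/\ 0 <= sigma, forall x, sigma * norm x <= norm (M *m x)
    & exists x, norm x = 1 /\ norm (M *m x) = sigma].
Proof.
move=> n0; set N := M^T *m M.
have Nsym : N^T = N by rewrite trmx_mul trmxK.
have MN x : norm (M *m x) ^+ 2 = dot x (N *m x).
  by rewrite sqr_norm dot_mull mulmxA.
have [r [rE rw]] := symmetric_spectral Nsym.
have eig i : exists x, norm x = 1 /\ N *m x = r i *: x.
  have : eigenvalue N (r i).
    rewrite eigenvalue_root_char rE /root horner_prod.
    by rewrite (bigD1 i)//= !hornerE subrr mul0r.
  move=> /eigenvalueP[v vN v0].
  have vp : 0 < norm v^T.
    rewrite lt0r norm_eq0 norm_ge0 andbT.
    by apply: contraNneq v0 => /(congr1 trmx); rewrite trmxK trmx0 => ->.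
  exists ((norm v^T)^-1 *: v^T); split.
    by rewrite normZ ger0_norm ?invr_ge0// mulVf ?gt_eqF.
  by rewrite -{1}Nsym -scalemxAr -trmx_mul vN linearZ/= scalerA mulrC -scalerA.
have r0 i : 0 <= r i.
  have [x [x1 Nx]] := eig i.
  have : 0 <= dot x (N *m x) by rewrite -MN sqr_ge0.
  by rewrite Nx dotZr -sqr_norm x1 expr1n mulr1.
set L := singular_values M in sigma *.
have permL : perm_eq L [seq Num.sqrt (r i) | i <- enum 'I_n].
  rewrite /L /singular_values -/N perm_sort rE.
  rewrite (map_comp Num.sqrt r); apply: perm_map.
  have -> : \prod_i ('X - (r i)%:P) =
      \prod_(x <- [seq r i | i <- enum 'I_n]) ('X - x%:P).
    by rewrite big_map big_enum.
  exact: perm_roots_with_multiplicity.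
have szL : size L = n by rewrite (perm_size permL) size_map size_enum_ord.
have sL : sigma \in L by apply: mem_nth; rewrite szL prednK.
have [k sk] : exists k, sigma = Num.sqrt (r k).
  by move: sL; rewrite (perm_mem permL) => /mapP[k _ ->]; exists k.
have smin i : sigma <= Num.sqrt (r i).
  have : Num.sqrt (r i) \in L.
    by rewrite (perm_mem permL); apply/mapP; exists i; rewrite ?mem_enum.
  move=> /(nthP 0)[j jL <-].
  have sortL : sorted >=%R L.
    by apply: sort_sorted => x y; rewrite orbC; exact: le_total.
  apply: (@sorted_leq_nth _ >=%R _ _ 0 L sortL j n.-1) => //.
  - by move=> x y z /= xy yz; exact: le_trans xy.
  - exact: lexx.
  - by rewrite inE szL prednK.
  - by rewrite -ltnS prednK// -szL.
have sge0 : 0 <= sigma by rewrite sk sqrtr_ge0.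
split=> //.
  move=> x; rewrite -ler_sqr ?nnegrE ?mulr_ge0// MN exprMn sqr_norm.
  have [w [w0 -> ->]] := rw x.
  rewrite mulr_sumr ler_sum// => i _; rewrite ler_wpM2r//.
  by rewrite -[leRHS]sqr_sqrtr// ler_sqr ?nnegrE ?sqrtr_ge0.
have [x [x1 Nx]] := eig k; exists x; split=> //.
apply/eqP; rewrite -(@eqrXn2 _ 2)//; apply/eqP.
by rewrite MN Nx dotZr -sqr_norm x1 expr1n mulr1 sk sqr_sqrtr.
Qed.

End SmallestSingularValue.

(** * The angle across one step of a flow *)

Section PrincipalAngle.
Variable R : realType.
Local Notation norm := (@euclidean_norm R _).
Local Notation proj := (@orthogonal_projector R _).

Lemma sin_bounds (theta : R) : 0 <= theta <= pi ->
  theta * cos theta <= sin theta <= theta.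
Proof.
move=> /andP[t0 tpi].
have [c] : exists2 c, c \in `[0, theta]%R &
    sin theta - sin 0 = cos c * (theta - 0).
  apply: MVT_segment => //.
  exact/continuous_subspaceT/continuous_sin.
rewrite in_itv/= sin0 !subr0 => /andP[c0 ct] ->.
apply/andP; split; last by rewrite ler_piMl ?cos_le1.
rewrite mulrC ler_wpM2r//.
move: ct; rewrite le_eqVlt => /predU1P[->//|ct].
by rewrite ltW// ltr_cos// in_itv/= ?t0 ?c0// ltW// (lt_le_trans ct).
Qed.

(** The sine lies between [theta * cos theta] and [theta], and the cosine is at
    least [1 - sin theta]. *)
Lemma angle_sin_close (theta : R) : 0 <= theta <= pi -> 0 <= cos theta ->
  0 <= sin theta <= 1 / 2 ->
  `|theta - sin theta| <= 2 * sin theta ^+ 2.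
Proof.
move=> t0 c0 /andP[s0 s1].
have /andP[tc st] := sin_bounds t0; have := cos2Dsin2 theta.
set S := sin theta in s0 s1 tc st *; set c := cos theta in c0 tc *.
move=> cS; have c1S : 1 - S <= c.
  rewrite -ler_sqr ?nnegrE//; last by lra.
  by nra.
have th0 : 0 <= theta by lra.
have : theta * (1 - S) <= S by apply: le_trans tc; rewrite ler_wpM2l.
rewrite ger0_norm ?subr_ge0// => h.
have : theta <= 2 * S by nra.
by nra.
Qed.

Lemma norm_projE d s (V : {vspace 'cV[R]_d}) (B : 'M[R]_(d, s)) x :
  is_orthonormal_basis V B -> norm (proj V *m x) = norm (B^T *m x).
Proof.
move=> VB; rewrite (projectorE VB) -mulmxA norm_colmul//.
by case: VB.
Qed.

(** If [y] are the coordinates of [w] in the basis of [W], the matrix defining the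
    angle maps [y] to the coordinates of the projection of [w] onto [V].  So its
    smallest singular value, the cosine of the angle, is the least length of the
    projection of a unit vector of [W], and the sine is by Pythagoras the largest
    distance of such a vector to [V]. *)
Lemma max_principal_angleP s d (V W : {vspace 'cV[R]_d})
    (theta := max_principal_angle s V W) :
  (0 < s)%N -> \dim V = s -> \dim W = s ->
  [/\ 0 <= theta <= pi, 0 <= cos theta, 0 <= sin theta,
    (forall w, w \in W ->
      norm ((1%:M - proj V) *m w) <= sin theta * norm w)
    & exists w, [/\ w \in W, norm w = 1
        & norm ((1%:M - proj V) *m w) = sin theta]].
Proof.
move=> s0 dV dW.
have VB := orthonormal_basisP dV; have WB := orthonormal_basisP dW.
rewrite {}/theta /max_principal_angle.
set B := orthonormal_basis s V in VB *.
set D := orthonormal_basis s W in WB *.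
have [D1 WE] := WB.
have [] := smallest_singular_value (B^T *m D) s0.
set sigma := nth _ _ _ => sg0 sle [x0 [x01 x0s]]; set theta := acos _.
have projD x : norm (B^T *m D *m x) = norm (proj V *m (D *m x)).
  by rewrite (norm_projE _ VB) mulmxA.
have sg1 : sigma <= 1.
  by rewrite -x0s projD (le_trans (norm_proj_le _ _))// norm_colmul// x01.
have sg11 : -1 <= sigma <= 1 by lra.
have sinE : sin theta ^+ 2 = 1 - sigma ^+ 2.
  by rewrite sin_acos// sqr_sqrtr// subr_ge0 exprn_ile1.
have sin0 : 0 <= sin theta by rewrite sin_acos// sqrtr_ge0.
have complE x : norm ((1%:M - proj V) *m (D *m x)) ^+ 2 =
    norm x ^+ 2 - norm (B^T *m D *m x) ^+ 2.
  have := pythagoras V (D *m x); rewrite (norm_colmul x D1) => ->.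
  by rewrite projD addrAC subrr add0r.
split=> //.
- by rewrite acos_ge0// acos_lepi.
- by rewrite acosK// in_itv/=.
- move=> w; rewrite -WE => /memv_colspanP[x ->].
  rewrite (norm_colmul x D1) -ler_sqr ?nnegrE ?mulr_ge0// complE exprMn sinE.
  rewrite mulrBl mul1r lerB// -exprMn ler_sqr ?nnegrE ?mulr_ge0//.
- exists (D *m x0); split; first by rewrite -WE; apply/memv_colspanP; exists x0.
    by rewrite norm_colmul.
  apply/eqP; rewrite -(@eqrXn2 _ 2)//; apply/eqP.
  by rewrite complE x0s x01 sinE expr1n.
Qed.

(** The estimates on one step of length [h] that the geometry needs: [w] is the
    explicit Euler step from [v] up to second order, and the lengths of [v] and
    [w] are comparable.  Relating vectors of two subspaces, rather than applying
    a map, treats both directions alike and needs no inverse of the flow. *)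
Definition flow_partner d (L h : R) (A : 'M[R]_d) (v w : 'cV[R]_d) :=
  [/\ norm (w - v) <= 2 * L * h * norm v, norm v <= 2 * norm w
    & norm (w - v - h *: (A *m v)) <= 4 * L ^+ 2 * h ^+ 2 * norm v].

Definition flow_step d (L h : R) (A : 'M[R]_d) (V W : {vspace 'cV[R]_d}) :=
  (forall v, v \in V -> exists2 w, w \in W & flow_partner L h A v w) /\
  (forall w, w \in W -> exists2 v, v \in V & flow_partner L h A v w).

(** The speed at which [V] turns when moved by the linear system with coefficient
    [A]: the integrand of the continuous angular average. *)
Definition turning_rate d (A : 'M[R]_d) (V : {vspace 'cV[R]_d}) : R :=
  let P := proj V in spectral_norm ((1%:M - P) *m A *m P).

Lemma turning_rate_le d L (A : 'M[R]_d) (V : {vspace 'cV[R]_d}) :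
  0 <= L -> (forall x, norm (A *m x) <= L * norm x) ->
  turning_rate A V <= L.
Proof.
move=> L0 AL; apply: spectral_norm_le => x x1; rewrite -!mulmxA.
rewrite (le_trans (norm_compl_le _ _))// (le_trans (AL _))// ler_piMr//.
exact: le_trans (norm_proj_le _ _) x1.
Qed.

Section Step.
Variables (d : nat) (L h : R) (A : 'M[R]_d) (V W : {vspace 'cV[R]_d}).
Hypotheses (L1 : 1 <= L) (h0 : 0 < h) (hL : h * (8 * L) <= 1).
Hypothesis AL : forall x, norm (A *m x) <= L * norm x.
Hypothesis VW : flow_step L h A V W.

Let L0 : 0 <= L. Proof. exact: le_trans ler01 L1. Qed.

(** Projecting away [V] kills [v], so that only the Euler increment [h A v] and
    the second-order error survive in [w]. *)
Lemma compl_partner v w : v \in V -> flow_partner L h A v w ->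
  `|norm ((1%:M - proj V) *m w) - h * norm ((1%:M - proj V) *m (A *m v))|
    <= 4 * L ^+ 2 * h ^+ 2 * norm v.
Proof.
move=> vV [_ _]; set q := 1%:M - proj V; set r := _ - _ => rle.
have E : q *m w = h *: (q *m (A *m v)) + q *m r.
  by rewrite /r !mulmxBr (compl_id vV) subr0 -scalemxAr addrC subrK.
have hE : h * norm (q *m (A *m v)) = norm (h *: (q *m (A *m v))).
  by rewrite normZ ger0_norm// ltW.
have rq : norm (q *m r) <= norm r := norm_compl_le V r.
rewrite hE E; set u := h *: _; set z := q *m r in rq *.
have := normD u z; have := normB (u + z) z; rewrite addrK => h1 h2.
by rewrite ler_norml; apply/andP; split; lra.
Qed.

(** The hypotheses say that [S] is the largest distance to [V] of a unit vector of
    [W].  A maximiser in [W], compared with its partner in [V], bounds [S] above;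
    each vector of the unit ball of [V], compared with its partner in [W], bounds the turning
    rate above.  Partners have lengths with ratio [1 + O(h)], whence the relative
    corrections of second order. *)
Lemma sin_angle_step (S : R) : 0 <= S ->
  (forall w, w \in W -> norm ((1%:M - proj V) *m w) <= S * norm w) ->
  (exists w, [/\ w \in W, norm w = 1 & norm ((1%:M - proj V) *m w) = S]) ->
  `|S - h * turning_rate A V| <= 12 * L ^+ 2 * h ^+ 2 /\ S <= 4 * L * h.
Proof.
move=> S0 Sle [w [wW w1 wS]].
have fL := turning_rate_le V L0 AL; set f := turning_rate A V in fL *.
have f0 : 0 <= f := spectral_norm_ge0 _.
have hL0 : 0 <= L * h by rewrite mulr_ge0// ltW.
have hhL0 : 0 <= L ^+ 2 * h ^+ 2 by rewrite -exprMn exprn_ge0.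
have hf : 0 <= h * f by rewrite mulr_ge0// ltW.
have hfL : h * f <= L * h by rewrite mulrC ler_wpM2r// ltW.
have fP v : v \in V -> norm ((1%:M - proj V) *m (A *m v)) <= f * norm v.
  move=> vV; rewrite -{1}(proj_id vV) !mulmxA.
  exact: norm_mulmx_le.
have Lh8 : L * h <= 1 / 8 by have := hL; lra.
have LLhh : L ^+ 2 * h ^+ 2 <= L * h / 8.
  by rewrite -exprMn expr2 -[8^-1]div1r ler_wpM2l.
have up : S <= h * f + 12 * L ^+ 2 * h ^+ 2.
  have [v vV vw] := VW.2 _ wW; have := compl_partner vV vw.
  have [wv vw2 _] := vw; have := fP v vV.
  rewrite wS w1 in vw2 * => fv; rewrite ler_norml => /andP[_ h1].
  have : norm v <= norm w + norm (w - v).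
    by rewrite -[X in norm X <= _](subKr w) normB.
  rewrite w1; set nv := norm v in vw2 wv fv h1 * => nv1.
  have nv0 : 0 <= nv := norm_ge0 v.
  have nv2 : nv <= 1 + 4 * L * h by nra.
  have : h * norm ((1%:M - proj V) *m (A *m v)) <= h * f * (1 + 4 * L * h).
    rewrite -mulrA ler_wpM2l ?(ltW h0)//; apply: le_trans fv _.
    by rewrite ler_wpM2l.
  have : h * f * (4 * L * h) <= 4 * (L ^+ 2 * h ^+ 2).
    rewrite (_ : 4 * (L ^+ 2 * h ^+ 2) = L * h * (4 * L * h)); last by ring.
    by rewrite ler_wpM2r// -mulrA mulr_ge0.
  have : L ^+ 2 * h ^+ 2 * nv <= L ^+ 2 * h ^+ 2 * 2 by rewrite ler_wpM2l//; lra.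
  by lra.
split; last by lra.
rewrite ler_norml; apply/andP; split; last by lra.
have : f <= (S + 12 * L ^+ 2 * h ^+ 2) / h.
  apply: spectral_norm_le => x x1; rewrite -!mulmxA ler_pdivlMr// mulrC.
  set v := proj V *m x; have vV : v \in V by exact: mem_proj.
  have v1 : norm v <= 1 := le_trans (norm_proj_le V x) x1.
  have [z zW vz] := VW.1 _ vV; have := compl_partner vV vz.
  have [zv _ _] := vz; have := Sle z zW.
  rewrite ler_norml => h1 /andP[h2 _].
  have : norm z <= norm v + norm (z - v).
    by rewrite -[X in norm X <= _](subrK v) addrC normD.
  set nv := norm v in v1 zv h2 *; set nz := norm z in h1 * => h3.
  have nv0 : 0 <= nv := norm_ge0 v.
  have nz1 : nz <= 1 + 2 * L * h.
    have : L * h * nv <= L * h * 1 by rewrite ler_wpM2l.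
    lra.
  have : S * nz <= S * (1 + 2 * L * h) by rewrite ler_wpM2l.
  have : S * (2 * L * h) <= 8 * (L ^+ 2 * h ^+ 2).
    rewrite (_ : 8 * (L ^+ 2 * h ^+ 2) = 4 * L * h * (2 * L * h)); last by ring.
    by rewrite ler_wpM2r//; lra.
  have : L ^+ 2 * h ^+ 2 * nv <= L ^+ 2 * h ^+ 2 * 1 by rewrite ler_wpM2l.
  by lra.
by rewrite ler_pdivlMr//; lra.
Qed.

(** The constant is [12] from [sin_angle_step] plus [2 * 4 ^ 2], since the sine
    is at most [4 L h]. *)
Lemma angle_step s : (0 < s)%N -> \dim V = s -> \dim W = s ->
  `|max_principal_angle s V W - h * turning_rate A V| <= 44 * L ^+ 2 * h ^+ 2.
Proof.
move=> s0 dV dW; have Lh8 : L * h <= 1 / 8 by have := hL; lra.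
have [t0 c0 sin0 Sle Sex] := max_principal_angleP s0 dV dW.
have [h1 h2] := sin_angle_step sin0 Sle Sex.
set theta := max_principal_angle s V W in t0 c0 sin0 h1 h2 *.
have : `|theta - sin theta| <= 2 * sin theta ^+ 2.
  by apply: angle_sin_close => //; rewrite sin0/=; lra.
have hL0 : 0 <= L * h by rewrite mulr_ge0// ltW.
have : sin theta ^+ 2 <= (4 * L * h) ^+ 2.
  by rewrite ler_sqr ?nnegrE// -mulrA mulr_ge0.
have -> : (4 * L * h) ^+ 2 = 16 * L ^+ 2 * h ^+ 2 by ring.
move=> h3 h4; have := ler_distD (sin theta) theta (h * turning_rate A V).
lra.
Qed.

(** With [P] and [Q] the projectors onto [V] and [W], write [Q - P] as
    [(1 - P) Q - P (1 - Q)]: the first summand is controlled by the distance of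
    [W] to [V] and the second, after taking adjoints, by that of [V] to [W]. *)
Lemma proj_step x : norm ((proj W - proj V) *m x) <= 6 * L * h * norm x.
Proof.
have hL0 : 0 <= L * h by rewrite mulr_ge0// ltW.
have -> : (proj W - proj V) *m x =
    (1%:M - proj V) *m (proj W *m x) - proj V *m ((1%:M - proj W) *m x).
  by rewrite !mulmxBl !mul1mx !mulmxBr opprB addrA subrK.
apply: le_trans (normB _ _) _.
have h1 : norm ((1%:M - proj V) *m (proj W *m x)) <= 4 * L * h * norm x.
  set w := proj W *m x; have wW : w \in W by exact: mem_proj.
  have wx : norm w <= norm x := norm_proj_le W x.
  have [v vV [wv vw _]] := VW.2 _ wW.
  rewrite -[w in _ *m w](subrK v) mulmxDr (compl_id vV) addr0.
  apply: le_trans (norm_compl_le _ _) _; apply: le_trans wv _.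
  have : L * h * norm v <= L * h * (2 * norm x) by rewrite ler_wpM2l//; lra.
  lra.
have h2 : norm (proj V *m ((1%:M - proj W) *m x)) <= 2 * L * h * norm x.
  apply: norm_le_dot; first by rewrite -!mulrA !mulr_ge0// ltW.
  set y := proj V *m _; have yV : y \in V by exact: mem_proj.
  have -> : dot y y = dot ((1%:M - proj W) *m y) x.
    by rewrite {2}/y -proj_selfadjoint (proj_id yV) compl_selfadjoint.
  apply: le_trans (cauchy_schwarz _ _) _.
  have [w wW [wy _ _]] := VW.1 _ yV.
  rewrite mulrAC ler_wpM2r//.
  rewrite -[y in _ *m y](subKr w) mulmxBr (compl_id wW) sub0r normN.
  exact: le_trans (norm_compl_le _ _) wy.
lra.
Qed.

(** Telescoping over the three factors of [(1 - P) A P], two of which move by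
    [6 L h] and one by [L h]. *)
Lemma turning_rate_step (A' : 'M[R]_d) :
  (forall x, norm (A' *m x) <= L * norm x) ->
  (forall x, norm ((A' - A) *m x) <= L * h * norm x) ->
  `|turning_rate A' W - turning_rate A V| <= 13 * L ^+ 2 * h.
Proof.
move=> A'L AA'; set P := proj V; set Q := proj W.
have LLh : L * h <= L ^+ 2 * h by rewrite expr2 -mulrA ler_peMl// mulr_ge0// ltW.
have hL0 : 0 <= L * h by rewrite mulr_ge0// ltW.
have key x : norm x <= 1 ->
    norm (((1%:M - Q) *m A' *m Q) *m x - ((1%:M - P) *m A *m P) *m x)
      <= 13 * L ^+ 2 * h.
  move=> x1.
  have -> : (1%:M - Q) *m A' *m Q *m x - (1%:M - P) *m A *m P *m x =
      - ((Q - P) *m (A' *m (Q *m x))) + (1%:M - P) *m ((A' - A) *m (Q *m x))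
      + (1%:M - P) *m (A *m ((Q - P) *m x)).
    rewrite -!mulmxA !(mulmxBl, mulmxBr, mul1mx).
    move: (A' *m (Q *m x)) (A *m (P *m x)) (A *m (Q *m x)) => a b c.
    move: (Q *m a) (P *m a) (P *m b) (P *m c) => qa pa pb pc.
    by apply/matrixP => i j; rewrite !mxE; lra.
  have Qx : norm (Q *m x) <= 1 := le_trans (norm_proj_le W x) x1.
  have b1 : norm ((Q - P) *m (A' *m (Q *m x))) <= 6 * L ^+ 2 * h.
    apply: le_trans (proj_step _) _.
    have : L * h * norm (A' *m (Q *m x)) <= L * h * L.
      by rewrite ler_wpM2l// (le_trans (A'L _))// ler_piMr.
    lra.
  have b2 : norm ((1%:M - P) *m ((A' - A) *m (Q *m x))) <= L * h.
    apply: le_trans (norm_compl_le _ _) _; apply: le_trans (AA' _) _.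
    by rewrite ler_piMr.
  have b3 : norm ((1%:M - P) *m (A *m ((Q - P) *m x))) <= 6 * L ^+ 2 * h.
    apply: le_trans (norm_compl_le _ _) _; apply: le_trans (AL _) _.
    have := proj_step x; rewrite -/P -/Q => h1.
    have : L * norm ((Q - P) *m x) <= L * (6 * L * h).
      rewrite ler_wpM2l// (le_trans h1)// ler_piMr// -mulrA mulr_ge0//.
    lra.
  apply: le_trans (normD _ _) _.
  have := normD (- ((Q - P) *m (A' *m (Q *m x))))
    ((1%:M - P) *m ((A' - A) *m (Q *m x))).
  rewrite normN; lra.
rewrite ler_norml; apply/andP; split.
  suff : turning_rate A V <= turning_rate A' W + 13 * L ^+ 2 * h by lra.
  apply: spectral_norm_le => x x1.
  have := normB ((1%:M - Q) *m A' *m Q *m x)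
    ((1%:M - Q) *m A' *m Q *m x - (1%:M - P) *m A *m P *m x).
  rewrite subKr => /le_trans; apply; rewrite lerD ?key//.
  apply: le_trans (norm_mulmx_le _ _) _; rewrite ler_piMr//.
  exact: spectral_norm_ge0.
rewrite lerBlDl; apply: spectral_norm_le => x x1.
have := normD ((1%:M - P) *m A *m P *m x)
    ((1%:M - Q) *m A' *m Q *m x - (1%:M - P) *m A *m P *m x).
rewrite addrC subrK => /le_trans; apply; rewrite lerD ?key//.
apply: le_trans (norm_mulmx_le _ _) _; rewrite ler_piMr//.
exact: spectral_norm_ge0.
Qed.

End Step.

End PrincipalAngle.

(** * Calculus on the half-line *)

Section HalflineCalculus.
Variable R : realType.
Local Notation norm := (@euclidean_norm R _).

(** A form of continuity on the half-line that differentiability provides and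
    that passes to Euclidean norms, where derivatives may fail to exist. *)
Definition pointwise_lipschitz (g : R -> R) :=
  forall t, 0 <= t -> exists K delta, [/\ 0 <= K, 0 < delta &
    forall u, 0 <= u -> `|u - t| < delta -> `|g u - g t| <= K * `|u - t|].

Lemma pointwise_lipschitz_continuous g a b : pointwise_lipschitz g -> 0 <= a ->
  {within `[a, b], continuous g}.
Proof.
move=> gl a0; apply/subspace_continuousP => t /=; rewrite in_itv/= => /andP[at_ _].
have [K [delta [K0 d0 Kd]]] := gl t (le_trans a0 at_).
apply/cvgrPdist_le => e e0.
have m0 : 0 < Num.min delta (e / (K + 1)).
  by rewrite lt_min d0 divr_gt0// ltr_wpDl.
rewrite near_withinE; apply/nbhs_ballP; exists (Num.min delta (e / (K + 1))) => //.
move=> u; rewrite /ball/= lt_min distrC => /andP[ud ue] /=.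
rewrite in_itv/= => /andP[au _].
rewrite distrC (le_trans (Kd u (le_trans a0 au) ud))//.
apply: (@le_trans _ _ ((K + 1) * `|u - t|)); first by rewrite ler_wpM2r// lerDl.
by rewrite mulrC -ler_pdivlMr ?ltW// ltr_wpDl.
Qed.

Lemma mx_entry_le m n (M : 'M[R]_(m, n)) i j : `|M i j| <= `|M|.
Proof.
rewrite [leRHS]/Num.Def.normr /= mx_normrE; apply/bigmax_geP; right => /=.
by exists (i, j).
Qed.

Lemma norm_mulmx_le_mxnorm m n (M : 'M[R]_(m, n)) x :
  norm (M *m x) <= (m * n)%:R * `|M| * norm x.
Proof. by apply: norm_mulmx_le_entries => i j; exact: mx_entry_le. Qed.

Section Derivative.
Variables (m n : nat) (F : R -> 'M[R]_(m, n)).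

Lemma derive_halfline_approx t D e : is_derive_halfline F t D -> 0 < e ->
  exists2 delta, 0 < delta & forall u, 0 <= u -> `|u - t| < delta ->
    `|F u - F t - (u - t) *: D| <= e * `|u - t|.
Proof.
move=> /cvgr_dist_le/(_ _) FD e0.
have /nbhs_ballP[delta /= d0 dF] := FD e e0.
exists delta => // u u0 ud.
have [->|ut] := eqVneq u t; first by rewrite !subrr scale0r subrr !normr0 mulr0.
have ut0 : u - t != 0 by rewrite subr_eq0.
have := dF u; rewrite /ball/= distrC => /(_ ud ut).
rewrite /halfline/= in_itv/= andbT => /(_ u0).
move=> h; rewrite distrC -[F u - F t]scale1r -(divff ut0) -scalerA -scalerBr normrZ.
by rewrite mulrC ler_wpM2r.
Qed.

Lemma derive_halfline_lipschitz t D : is_derive_halfline F t D ->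
  exists K delta, [/\ 0 <= K, 0 < delta & forall u, 0 <= u -> `|u - t| < delta ->
    `|F u - F t| <= K * `|u - t|].
Proof.
move=> FD; have [delta d0 dF] := derive_halfline_approx FD ltr01.
exists (1 + `|D|), delta; split=> // u u0 ud; have := dF u u0 ud.
rewrite -[F u - F t](subrK ((u - t) *: D)).
set X := _ - _ => h; apply: le_trans (ler_normD _ _) _.
rewrite mulrDl normrZ [`|D| * _]mulrC lerD2r.
by rewrite [leLHS](_ : _ = `|X|)// /X addrK.
Qed.

Variables (D : R -> 'M[R]_(m, n)).
Hypothesis FD : forall t, 0 <= t -> is_derive_halfline F t (D t).

Lemma mulmx_pointwise_lipschitz x t : 0 <= t ->
  exists K delta, [/\ 0 <= K, 0 < delta & forall u, 0 <= u -> `|u - t| < delta ->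
    norm (F u *m x - F t *m x) <= K * `|u - t|].
Proof.
move=> t0; have [K [delta [K0 d0 dF]]] := derive_halfline_lipschitz (FD t0).
exists ((m * n)%:R * K * norm x), delta; split; rewrite ?mulr_ge0// => u u0 ud.
rewrite -mulmxBl; apply: le_trans (norm_mulmx_le_mxnorm _ _) _.
rewrite -!mulrA ler_wpM2l// [norm x * _]mulrC mulrA ler_wpM2r//.
exact: dF.
Qed.

Lemma norm_pointwise_lipschitz x : pointwise_lipschitz (fun u => norm (F u *m x)).
Proof.
move=> t /(mulmx_pointwise_lipschitz x)[K [delta [K0 d0 dF]]].
exists K, delta; split=> // u u0 ud.
exact: le_trans (norm_dist_le _ _) (dF u u0 ud).
Qed.

Lemma dot_pointwise_lipschitz y x :
  pointwise_lipschitz (fun u => dot y (F u *m x)).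
Proof.
move=> t /(mulmx_pointwise_lipschitz x)[K [delta [K0 d0 dF]]].
exists (norm y * K), delta; split; rewrite ?mulr_ge0// => u u0 ud.
rewrite -dotNr -dotDr -mulrA; apply: le_trans (abs_dot_le _ _) _.
by rewrite ler_wpM2l// dF.
Qed.

(** The form in which all derivatives are used: one scalar function [y . F(u) x]
    covers the matrix entries, with [x] and [y] unit vectors, as well as the
    solutions of the linear system tested against [y]. *)
Lemma dot_MVT y x a b : 0 <= a -> a <= b ->
  exists2 c, a <= c <= b &
    dot y (F b *m x) - dot y (F a *m x) = dot y (D c *m x) * (b - a).
Proof.
move=> a0 ab.
have [c] : exists2 c, c \in `[a, b]%R &
    dot y (F b *m x) - dot y (F a *m x) = dot y (D c *m x) * (b - a).
  apply: (@MVT_segment _ (fun u => dot y (F u *m x))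
    (fun c => dot y (D c *m x))) => //; last first.
    by apply: pointwise_lipschitz_continuous => //; exact: dot_pointwise_lipschitz.
  move=> t; rewrite in_itv/= => /andP[at_ tb].
  have t0 : 0 < t := le_lt_trans a0 at_.
  suff H : (fun h => h^-1 *: (((fun u => dot y (F u *m x)) \o shift t) (h *: 1)
      - dot y (F t *m x))) @ 0^' --> dot y (D t *m x).
    by split; [apply/cvg_ex; eexists; exact: H|exact: cvg_lim H].
  apply/cvgrPdist_le => e e0.
  pose C := norm y * ((m * n)%:R * norm x) + 1.
  have C0 : 0 < C by rewrite ltr_wpDl// !mulr_ge0.
  have [delta d0 dF] := derive_halfline_approx (FD (ltW t0)) (divr_gt0 e0 C0).
  apply/nbhs_ballP; exists (Num.min delta t) => /=.
    by rewrite lt_min d0.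
  move=> h; rewrite /ball/= sub0r normrN lt_min => /andP[hd ht] h0.
  have ht0 : 0 <= h + t by move: ht; rewrite ltr_norml => /andP[h1 _]; lra.
  have hne : `|h| != 0 by rewrite normr_eq0.
  have := dF (h + t) ht0; rewrite addrK => /(_ hd) H.
  rewrite [h *: 1]mulr1 -[X in `|X|](mulKf h0) normrM normfV mulrC.
  rewrite ler_pdivrMr ?normr_gt0//.
  have -> : h * (dot y (D t *m x) -
      h^-1 *: (dot y (F (h + t) *m x) - dot y (F t *m x))) =
    - dot y ((F (h + t) - F t - h *: D t) *m x).
    rewrite mulrBr [h^-1 *: _]/(h^-1 * _) mulVKf// !mulmxBl -scalemxAl.
    by rewrite !(dotDr, dotNr, dotZr); ring.
  have h1 := norm_mulmx_le_mxnorm (F (h + t) - F t - h *: D t) x.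
  set X := _ - _ in H h1 *.
  rewrite normrN (le_trans (abs_dot_le _ _))//.
  apply: (@le_trans _ _ (norm y * ((m * n)%:R * norm x) * (e / C * `|h|))).
    rewrite -mulrA ler_wpM2l// (le_trans h1)// -!mulrA ler_wpM2l// mulrC ler_wpM2l//.
    by rewrite mulrA.
  apply: (@le_trans _ _ (C * (e / C * `|h|))).
    rewrite ler_wpM2r ?lerDl// !mulr_ge0// ?ltW// invr_gt0//.
  by rewrite mulrA mulrCA divff ?mulr1// gt_eqF.
by rewrite in_itv/=; exists c.
Qed.

End Derivative.

(** The bound is taken at least [1], so that in the error terms [L] is dominated
    by its square. *)
Lemma C1b_bounds n (A : R -> 'M[R]_n) : C1b A -> exists L, [/\ 1 <= L,
  forall t x, 0 <= t -> norm (A t *m x) <= L * norm x &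
  forall t u x, 0 <= t -> t <= u ->
    norm ((A u - A t) *m x) <= L * (u - t) * norm x].
Proof.
move=> [A' [dA [_ /pinfty_ex_gt0[M M0 AM]] [_ /pinfty_ex_gt0[M' M'0 AM']]]].
pose c := (n * n)%:R * Num.max M M' + 1.
have nn0 : 0 <= (n * n)%:R :> R by [].
exists c; split.
- by rewrite lerDr mulr_ge0// le_max (ltW M0).
- move=> t x t0; apply: le_trans (norm_mulmx_le_mxnorm _ _) _.
  rewrite ler_wpM2r// (@le_trans _ _ ((n * n)%:R * Num.max M M'))//; last by rewrite lerDl.
  rewrite ler_wpM2l// le_max; apply/orP; left; apply: AM.
  by rewrite /halfline/= in_itv/= t0.
- move=> t u x t0 tu.
  have H i j : `|(A u - A t) i j| <= M' * (u - t).
    have [z /andP[tz zu]] := dot_MVT dA (delta_mx i 0) (delta_mx j 0) t0 tu.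
    have E B : dot (delta_mx i 0) (B *m delta_mx j 0) = B i j.
      by rewrite /dot trmx_delta -colE -rowE !mxE.
    rewrite !E => e; rewrite !mxE e normrM (ger0_norm (_ : 0 <= u - t)) ?subr_ge0//.
    rewrite ler_wpM2r ?subr_ge0//; apply: le_trans (mx_entry_le _ _ _) _; apply: AM'.
    by rewrite /halfline/= in_itv/= (le_trans t0).
  apply: le_trans (norm_mulmx_le_entries _ H) _.
  rewrite ler_wpM2r// mulrA ler_wpM2r ?subr_ge0//.
  rewrite (@le_trans _ _ ((n * n)%:R * Num.max M M'))//; last by rewrite lerDl.
  by rewrite ler_wpM2l// le_max lexx orbT.
Qed.

End HalflineCalculus.

(** * The flow of a linear system over a short time *)

Section Flow.
Variables (R : realType) (d : nat) (A : R -> 'M[R]_d) (Phi : R -> R -> 'M[R]_d).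
Hypothesis hPhi : solution_operator A Phi.
Variable L : R.
Hypothesis L1 : 1 <= L.
Hypothesis AL : forall (t : R) (x : 'cV[R]_d), 0 <= t ->
  euclidean_norm (A t *m x) <= L * euclidean_norm x.
Hypothesis AL' : forall (t u : R) (x : 'cV[R]_d), 0 <= t -> t <= u ->
  euclidean_norm ((A u - A t) *m x) <= L * (u - t) * euclidean_norm x.
Local Notation norm := (@euclidean_norm R _).
Implicit Types (x : 'cV[R]_d) (t a b c : R).
Local Notation flow t x := (Phi t 0 *m x).
Local Notation orbit V t := (image_subspace (Phi t 0) V).

Let L0 : 0 <= L. Proof. exact: le_trans ler01 L1. Qed.

Lemma flow0 x : flow 0 x = x.
Proof. by have [-> _] := hPhi (lexx 0); rewrite mul1mx. Qed.

Lemma flow_derivative t : 0 <= t ->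
  is_derive_halfline (fun u => Phi u 0) t (A t *m Phi t 0).
Proof. by have [_] := hPhi (lexx 0); apply. Qed.

(** The maximum [M] of a solution over a short interval satisfies
    [M <= norm (x a) + L h M] with [8 L h <= 1], so it is absorbed on the left;
    this plays the part of Gronwall's inequality. *)
Lemma flow_short x a b : 0 <= a -> a <= b -> (b - a) * (8 * L) <= 1 ->
  forall c, a <= c <= b ->
    norm (flow c x) <= 2 * norm (flow a x) /\
    norm (flow c x - flow a x) <= 2 * L * (b - a) * norm (flow a x).
Proof.
move=> a0 ab hL.
have cont : {within `[a, b], continuous (fun u => norm (flow u x))}.
  apply: pointwise_lipschitz_continuous => //.
  exact: norm_pointwise_lipschitz flow_derivative _.
have [m mab mmax] := EVT_max ab cont.
set M := norm (flow m x) in mmax.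
have M0 : 0 <= M := norm_ge0 _.
have Lh0 : 0 <= L * (b - a) by rewrite mulr_ge0// subr_ge0.
have Lh8 : L * (b - a) <= 1 / 8 by move: hL; lra.
have step c : a <= c <= b -> norm (flow c x - flow a x) <= L * (b - a) * M.
  move=> /andP[ac cb]; apply: norm_le_dot; first by rewrite mulr_ge0.
  set y := flow c x - flow a x.
  have [z /andP[az zc]] := dot_MVT flow_derivative y x a0 ac.
  rewrite -dotNr -dotDr -/y => ->.
  rewrite -mulmxA [leRHS]mulrC mulrA.
  have z0 : 0 <= z := le_trans a0 az.
  have h1 : dot y (A z *m flow z x) <= norm y * (L * M).
    apply: le_trans (cauchy_schwarz _ _) _; rewrite ler_wpM2l//.
    apply: le_trans (AL _ z0) _; rewrite ler_wpM2l// mmax// in_itv/= az.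
    exact: le_trans cb.
  apply: le_trans (ler_wpM2r _ h1) _; first by rewrite subr_ge0.
  rewrite -!mulrA ler_wpM2l// ler_wpM2l// [leRHS]mulrC ler_wpM2l//.
  by rewrite lerB.
have M2 : M <= 2 * norm (flow a x).
  have := mab; rewrite in_itv/= => /step h1.
  have := normD (flow m x - flow a x) (flow a x); rewrite subrK -/M.
  have : L * (b - a) * M <= 1 / 8 * M by rewrite ler_wpM2r.
  have := norm_ge0 (flow a x).
  move: h1 (norm_ge0 (flow a x)); move: (norm _) (norm _) => p q; lra.
move=> c cab; split.
  by apply: le_trans M2; apply: mmax; rewrite in_itv.
apply: le_trans (step _ cab) _.
have : L * (b - a) * M <= L * (b - a) * (2 * norm (flow a x)) by rewrite ler_wpM2l.
lra.
Qed.

(** The increment of a solution is [h] times its derivative [A x] at some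
    intermediate time, and [A x] moves by [O(h)] over the step because both [A]
    and [x] do. *)
Lemma flow_partnerP x a b : 0 <= a -> a <= b -> (b - a) * (8 * L) <= 1 ->
  flow_partner L (b - a) (A a) (flow a x) (flow b x).
Proof.
move=> a0 ab hL.
have short := flow_short x a0 ab hL.
have bab : a <= b <= b by rewrite ab lexx.
have h2 := (short b bab).2.
have Lh8 : L * (b - a) <= 1 / 8 by move: hL; lra.
have ba0 : 0 <= b - a by rewrite subr_ge0.
have Lh0 : 0 <= L * (b - a) by rewrite mulr_ge0.
set n0 := norm (flow a x) in h2.
have n00 : 0 <= n0 := norm_ge0 _.
split=> //.
  have := normB (flow b x) (flow b x - flow a x); rewrite subKr -/n0.
  have : L * (b - a) * n0 <= 1 / 8 * n0 by rewrite ler_wpM2r.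
  by move: h2; lra.
apply: norm_le_dot; first by rewrite !mulr_ge0.
set y := _ - _ - _.
have [z /andP[az zb]] := dot_MVT flow_derivative y x a0 ab.
have z0 : 0 <= z := le_trans a0 az.
have [zz1 zz2] := short z (introT andP (conj az zb)).
rewrite -dotNr -dotDr => e.
have -> : dot y y = (b - a) *
    dot y ((A z - A a) *m flow z x + A a *m (flow z x - flow a x)).
  rewrite {2}/y dotDr dotNr e dotZr mulrC -mulrBr; congr (_ * _).
  rewrite -mulmxA -dotNr -dotDr; congr dot.
  by rewrite mulmxBl mulmxBr addrA subrK.
have h3 : norm ((A z - A a) *m flow z x + A a *m (flow z x - flow a x)) <=
    4 * L ^+ 2 * (b - a) * n0.
  apply: le_trans (normD _ _) _.
  have h4 : norm ((A z - A a) *m flow z x) <= L * (b - a) * (2 * n0).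
    apply: le_trans (AL' _ a0 az) _; apply: ler_pM => //.
      by rewrite mulr_ge0// subr_ge0.
    by rewrite ler_wpM2l// lerB.
  have h5 : norm (A a *m (flow z x - flow a x)) <= L * (2 * L * (b - a) * n0).
    by apply: le_trans (AL _ a0) _; rewrite ler_wpM2l.
  have h6 : L * (b - a) * n0 <= L * (L * (b - a) * n0).
    by rewrite ler_peMl// mulr_ge0.
  rewrite expr2; move: h4 h5 h6; lra.
rewrite [leRHS](_ : _ = (b - a) * (norm y * (4 * L ^+ 2 * (b - a) * n0))); last first.
  by rewrite -/n0; ring.
rewrite ler_wpM2l// (le_trans (cauchy_schwarz _ _))// ler_wpM2l//.
Qed.

(** Going back by steps of length [1 / (8 L)], each of which at most doubles the
    norm, a solution that vanishes at one time vanishes at time 0. *)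
Lemma flow_eq0 x t : 0 <= t -> flow t x = 0 -> x = 0.
Proof.
have Lp : 0 < 8 * L by rewrite mulr_gt0// (lt_le_trans ltr01).
pose e := (8 * L)^-1; have e0 : 0 < e by rewrite invr_gt0.
suff H n : forall t, 0 <= t -> t <= n%:R * e -> flow t x = 0 -> x = 0.
  move=> t0; apply: (H (Num.truncn (t / e)).+1) => //.
  rewrite -ler_pdivrMr//; have /andP[_ /ltW] := truncn_itv (divr_ge0 t0 (ltW e0)).
  by [].
elim: n => [|n IH] {}t t0 tn xt.
  have t00 : t = 0 by apply/eqP; rewrite eq_le t0 andbT (le_trans tn)// mul0r.
  by rewrite -xt t00 flow0.
have [te|et] := leP t e.
  have := flow_partnerP x (lexx 0) t0; rewrite subr0 => H.
  have : t * (8 * L) <= 1 by rewrite -ler_pdivlMr// div1r.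
  move=> /H[_ + _]; rewrite xt norm0 mulr0 flow0 => x0.
  by apply/eqP; rewrite -norm_eq0 eq_le x0 norm_ge0.
have te0 : 0 <= t - e by rewrite subr_ge0 ltW.
have tet : t - e <= t by rewrite gerBl ltW.
apply: (IH (t - e)) => //; first by move: tn; rewrite -natr1; lra.
have := flow_partnerP x te0 tet.
rewrite opprB addrCA subrr addr0 mulVf ?gt_eqF// => /(_ (lexx 1))[_ + _].
by rewrite xt norm0 mulr0 => x0; apply/eqP; rewrite -norm_eq0 eq_le x0 norm_ge0.
Qed.

Lemma mem_image_subspace (M : 'M[R]_d) (V : {vspace 'cV[R]_d}) y :
  y \in image_subspace M V <-> exists2 v, v \in V & y = M *m v.
Proof.
split=> [/memv_imgP[v vV ->]|[v vV ->]].
  by exists v => //; rewrite lfunE.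
by apply/memv_imgP; exists v => //; rewrite lfunE.
Qed.

Lemma dim_orbit (V : {vspace 'cV[R]_d}) t : 0 <= t -> \dim (orbit V t) = \dim V.
Proof.
move=> t0; apply: limg_dim_eq; apply/eqP; rewrite -subv0; apply/subvP => x.
rewrite memv_cap memv_ker lfunE/= => /andP[_ /eqP/(flow_eq0 t0) ->].
exact: mem0v.
Qed.

Lemma orbit_flow_step (V : {vspace 'cV[R]_d}) a b : 0 <= a -> a <= b ->
  (b - a) * (8 * L) <= 1 -> flow_step L (b - a) (A a) (orbit V a) (orbit V b).
Proof.
move=> a0 ab hL; split=> _ /mem_image_subspace[x xV ->].
  exists (flow b x); last exact: flow_partnerP.
  by apply/mem_image_subspace; exists x.
exists (flow a x); last exact: flow_partnerP.
by apply/mem_image_subspace; exists x.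
Qed.

Definition orbit_turning_rate V t := turning_rate (A t) (orbit V t).

Lemma orbit_turning_rate_lipschitz V a b : 0 <= a -> a <= b ->
  (b - a) * (8 * L) <= 1 ->
  `|orbit_turning_rate V b - orbit_turning_rate V a| <= 13 * L ^+ 2 * (b - a).
Proof.
move=> a0 ab hL; have [<-|neq] := eqVneq a b; first by rewrite !subrr normr0 mulr0.
have ba : 0 < b - a by rewrite subr_gt0 lt_neqAle neq.
rewrite /orbit_turning_rate; apply: (turning_rate_step L1 ba) => [x||x|x].
- exact: AL.
- exact: orbit_flow_step.
- exact: AL (le_trans a0 ab).
- exact: AL'.
Qed.

Lemma orbit_turning_rate_ge0 V t : 0 <= orbit_turning_rate V t.
Proof. exact: spectral_norm_ge0. Qed.

Lemma orbit_turning_rate_le V t : 0 <= t -> orbit_turning_rate V t <= L.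
Proof. by move=> t0; apply: turning_rate_le => // x; exact: AL. Qed.

Lemma orbit_turning_rate_continuous V T :
  {within `[0, T], continuous (orbit_turning_rate V)}.
Proof.
apply: pointwise_lipschitz_continuous => // t t0.
have Lp : 0 < 8 * L by rewrite mulr_gt0// (lt_le_trans ltr01).
exists (13 * L ^+ 2), (8 * L)^-1; split; rewrite ?invr_gt0//.
  by rewrite mulr_ge0// exprn_ge0.
move=> u u0 /ltW; rewrite -[(8 * L)^-1]div1r ler_pdivlMr// => utL.
have [tu|/ltW ut] := leP t u.
  rewrite [`|u - t|]ger0_norm ?subr_ge0// in utL *.
  exact: orbit_turning_rate_lipschitz.
rewrite [`|u - t|]distrC in utL *; rewrite [leLHS]distrC.
rewrite [`|t - u|]ger0_norm ?subr_ge0// in utL *.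
exact: orbit_turning_rate_lipschitz.
Qed.

Lemma angle_orbit_step s V a h : (0 < s)%N -> \dim V = s -> 0 <= a -> 0 < h ->
  h * (8 * L) <= 1 ->
  `|max_principal_angle s (orbit V a) (orbit V (a + h)) - h * orbit_turning_rate V a|
    <= 44 * L ^+ 2 * h ^+ 2.
Proof.
move=> s0 dV a0 h0 hL; have ah : a <= a + h by rewrite lerDl ltW.
have hE : a + h - a = h by rewrite addrC addKr.
apply: angle_step => //; rewrite ?dim_orbit ?addr_ge0// ?(ltW h0)//.
  by move=> x; exact: AL.
by rewrite -[X in flow_step _ X]hE; apply: orbit_flow_step => //; rewrite hE.
Qed.

End Flow.

(** * Comparison of the two averages *)

Section Averages.
Variable R : realType.

Lemma integral_increment (f : R -> R) a b m M :
  0 <= a -> a <= b -> (forall T, {within `[0, T], continuous f}) ->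
  (forall x, a <= x <= b -> m <= f x <= M) ->
  m * (b - a) <= \int[lebesgue_measure]_(t in `[0, b]) f t
                 - \int[lebesgue_measure]_(t in `[0, a]) f t <= M * (b - a).
Proof.
move=> a0 ab cf mfM.
have intf : lebesgue_measure.-integrable `[0, b] (EFin \o f).
  by apply: continuous_compact_integrable => //; exact: segment_compact.
have mab : measurable (`]a, b] : set R) by exact: measurable_itv.
have intab : lebesgue_measure.-integrable `]a, b] (EFin \o f).
  apply: integrableS intf => // x /=; rewrite !in_itv/= => /andP[ax ->].
  by rewrite (le_trans a0 (ltW ax)).
have intc (c : R) : lebesgue_measure.-integrable `]a, b] (EFin \o (fun=> c)).
  have intcc : lebesgue_measure.-integrable `[a, b] (EFin \o (fun=> c)).
    apply: continuous_compact_integrable; first exact: segment_compact.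
    exact/continuous_subspaceT/cst_continuous.
  by apply: integrableS intcc => //; exact: subset_itv_oc_cc.
have cint (c : R) : \int[lebesgue_measure]_(t in `]a, b]) c = c * (b - a).
  rewrite Rintegral_cst//= lebesgue_measure_itv/= lte_fin.
  case: ltP => //= ba; have -> : b = a by apply/le_anti; rewrite ab ba.
  by rewrite subrr.
rewrite Rintegral_itvB//; [|by rewrite bnd_simp..].
have fab x : `]a, b]%classic x -> m <= f x <= M.
  by rewrite /= in_itv/= => /andP[/ltW ax xb]; apply: mfM; rewrite ax.
rewrite -!cint; apply/andP; split.
  by apply: le_Rintegral => // x /fab/andP[].
by apply: le_Rintegral => // x /fab/andP[].
Qed.

Lemma integral_0 (f : R -> R) : \int[lebesgue_measure]_(t in `[0, 0]) f t = 0.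
Proof. by rewrite set_itv1 Rintegral_set1. Qed.

End Averages.

Section Comparison.
Variables (R : realType) (d : nat) (A : R -> 'M[R]_d) (Phi : R -> R -> 'M[R]_d).
Hypothesis hPhi : solution_operator A Phi.
Variable L : R.
Hypothesis L1 : 1 <= L.
Hypothesis AL : forall (t : R) (x : 'cV[R]_d), 0 <= t ->
  euclidean_norm (A t *m x) <= L * euclidean_norm x.
Hypothesis AL' : forall (t u : R) (x : 'cV[R]_d), 0 <= t -> t <= u ->
  euclidean_norm ((A u - A t) *m x) <= L * (u - t) * euclidean_norm x.
Variables (s : nat) (V : {vspace 'cV[R]_d}).
Hypothesis s0 : (0 < s)%N.
Hypothesis dV : \dim V = s.
Variable h : R.
Hypothesis h0 : 0 < h.
Hypothesis hL : h * (8 * L) <= 1.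

Let f := orbit_turning_rate A Phi V.
Let I (T : R) : R := \int[lebesgue_measure]_(t in `[0, T]) f t.
Let K := 57 * L ^+ 2 * h ^+ 2.

Let L0 : 0 <= L. Proof. exact: le_trans ler01 L1. Qed.
Let fcont T : {within `[0, T], continuous f}.
Proof. exact: (orbit_turning_rate_continuous hPhi L1 AL AL'). Qed.

(** The constant [57] in [K] is [44] from the angle plus [13] from the variation
    of the integrand over the step. *)
Lemma angle_integral_step a : 0 <= a ->
  `|max_principal_angle s (image_subspace (Phi a 0) V)
      (image_subspace (Phi (a + h) 0) V) - (I (a + h) - I a)| <= K.
Proof.
move=> a0; have := angle_orbit_step hPhi L1 AL AL' s0 dV a0 h0 hL.
rewrite -/f; set theta := max_principal_angle _ _ _ => hth.
have ah : a <= a + h by rewrite lerDl ltW.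
have fE x : a <= x <= a + h ->
    f a - 13 * L ^+ 2 * h <= f x <= f a + 13 * L ^+ 2 * h.
  move=> /andP[ax xb]; rewrite -ler_distlC distrC.
  have xh : x - a <= h by rewrite lerBlDl.
  have : (x - a) * (8 * L) <= 1.
    by apply: le_trans hL; rewrite ler_wpM2r// mulr_ge0.
  move=> /(orbit_turning_rate_lipschitz hPhi L1 AL AL' V a0 ax) h1.
  by apply: le_trans h1 _; rewrite ler_wpM2l// mulr_ge0// exprn_ge0.
have := integral_increment a0 ah fcont fE; rewrite -/(I _) -/(I _).
rewrite [a + h - a]addrC addKr.
move: hth; rewrite /K !ler_norml => /andP[h1 h2] /andP[h3 h4].
by apply/andP; split; move: h1 h2 h3 h4; rewrite expr2; lra.
Qed.

Lemma sum_angles_integral N :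
  `|\sum_(1 <= j < N.+1) max_principal_angle s
       (image_subspace (Phi (j.-1%:R * h) 0) V)
       (image_subspace (Phi (j%:R * h) 0) V) - I (N%:R * h)| <= N%:R * K.
Proof.
elim: N => [|N IH].
  by rewrite big_nil !mul0r /I integral_0 subr0 normr0.
rewrite big_nat_recr//=; set S := \sum_(_ <= _ < _) _ in IH *.
have := angle_integral_step (mulr_ge0 (ler0n R N) (ltW h0)).
rewrite -[N.+1%:R]natr1 mulrDl mul1r; set theta := max_principal_angle _ _ _.
move: IH; rewrite mulrDl mul1r !ler_norml => /andP[h1 h2] /andP[h3 h4].
by apply/andP; split; lra.
Qed.

Lemma alpha_step_cont N : (0 < N)%N ->
  `|alpha_step s Phi h N V - alpha_cont A Phi (N%:R * h) V| <= 57 * L ^+ 2 * h.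
Proof.
move=> N0; rewrite /alpha_step /alpha_cont -mulrBr.
have Nh : 0 < N%:R * h by rewrite mulr_gt0// ltr0n.
rewrite normrM gtr0_norm ?invr_gt0// ler_pdivrMl//.
apply: le_trans (sum_angles_integral N) _.
by rewrite le_eqVlt; apply/orP; left; apply/eqP; rewrite /K; ring.
Qed.

(** Moving the end point of the average to the grid point below it costs [O(1/T)],
    hence at most [h] for large times. *)
Lemma alpha_step_truncn T : h <= T -> 2 * L <= T ->
  `|alpha_cont A Phi T V - alpha_step s Phi h (Num.truncn (T / h)) V|
    <= (57 * L ^+ 2 + 1) * h.
Proof.
move=> hT LT; set N := Num.truncn _.
have T0 : 0 < T := lt_le_trans h0 hT.
have /andP[NT TN] := truncn_itv (divr_ge0 (ltW T0) (ltW h0)).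
rewrite -/N in NT TN; rewrite ler_pdivlMr// in NT; rewrite ltr_pdivrMr// in TN.
have N0 : (0 < N)%N.
  by rewrite lt0n; apply/eqP => N00; move: TN; rewrite N00 mul1r ltNge hT.
have Nh : 0 < N%:R * h by rewrite mulr_gt0// ltr0n.
have := alpha_step_cont N0; set u := alpha_step _ _ _ _ _.
set t0 := N%:R * h in NT Nh *; move=> hu.
suff : `|alpha_cont A Phi T V - alpha_cont A Phi t0 V| <= h.
  move: hu; rewrite !ler_norml => /andP[h1 h2] /andP[h3 h4].
  by apply/andP; split; lra.
rewrite /alpha_cont -/(I _) -/(I _).
have Tt : T - t0 <= h by move: TN; rewrite -[N.+1%:R]natr1 mulrDl mul1r -/t0; lra.
have fL x : 0 <= x -> 0 <= f x <= L.
  by move=> x0; rewrite orbit_turning_rate_ge0 (orbit_turning_rate_le Phi L1 AL).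
have /andP[I1 I2] : 0 * (T - t0) <= I T - I t0 <= L * (T - t0).
  apply: integral_increment => // [|x /andP[tx _]]; first exact: ltW.
  by apply: fL; apply: le_trans tx; exact: ltW.
have /andP[J1 J2] : 0 * (t0 - 0) <= I t0 - I 0 <= L * (t0 - 0).
  apply: integral_increment => // [|x /andP[tx _]]; first exact: ltW.
  exact: fL.
rewrite /I integral_0 -/(I _) in J1 J2.
rewrite mul0r subr0 in J1; rewrite !subr0 in J2; rewrite mul0r in I1.
have IT : T^-1 * I T - t0^-1 * I t0 =
    T^-1 * ((I T - I t0) - (T - t0) * (t0^-1 * I t0)).
  by field; rewrite !gt_eqF.
(* The average over the last incomplete step against the average before it. *)
rewrite IT normrM gtr0_norm ?invr_gt0// ler_pdivrMl//.
have J3 : 0 <= t0^-1 * I t0 by rewrite mulr_ge0 ?invr_ge0 ?(ltW Nh).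
have J4 : t0^-1 * I t0 <= L by rewrite ler_pdivrMl// mulrC.
have Tt0 : 0 <= T - t0 by rewrite subr_ge0.
have LT2 : L * (T - t0) <= L * h by rewrite ler_wpM2l.
have LTh : 2 * L * h <= T * h by rewrite ler_wpM2r// ltW.
have J5 : (T - t0) * (t0^-1 * I t0) <= (T - t0) * L by rewrite ler_wpM2l.
have J6 : 0 <= (T - t0) * (t0^-1 * I t0) by rewrite mulr_ge0.
by rewrite ler_norml; apply/andP; split; lra.
Qed.

End Comparison.

(** * Lower and upper limits, Hausdorff distance *)

Section LimitRanges.
Variable R : realType.
Local Open Scope ereal_scope.

Section Superior.
Variables (TX TY : choiceType) (X : filteredType TX) (Y : filteredType TY).

(** [phi] carries the filter [F] to [G], so the values of [g] near [G] control
    those of [f] near [F]. *)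
Lemma limf_esup_le_comp (f : X -> \bar R) (F : set_system X) (g : Y -> \bar R)
    (G : set_system Y) (phi : X -> Y) (delta : R) : Filter F ->
  (forall V, G V -> F (phi @^-1` V)) ->
  F [set x | f x <= g (phi x) + delta%:E] ->
  limf_esup f F <= limf_esup g G + delta%:E.
Proof.
move=> FF phiG fg; rewrite -leeBlDr//.
apply: le_ereal_inf_tmp => _ [V GV <-]; rewrite leeBlDr//.
pose W := (phi @^-1` V) `&` [set x | f x <= g (phi x) + delta%:E].
have FW : F W by apply: filterI => //; exact: phiG.
apply: (@le_trans _ _ (ereal_sup (f @` W))).
  by apply: ereal_inf_lbound; exists W.
apply: ge_ereal_sup => _ [x [Vx /= fx] <-].
apply: le_trans fx _; rewrite leeD2r//.
by apply: ereal_sup_ubound; exists (phi x).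
Qed.

Lemma limf_einf_ge_comp (f : X -> \bar R) (F : set_system X) (g : Y -> \bar R)
    (G : set_system Y) (phi : X -> Y) (delta : R) : Filter F ->
  (forall V, G V -> F (phi @^-1` V)) ->
  F [set x | g (phi x) - delta%:E <= f x] ->
  limf_einf g G - delta%:E <= limf_einf f F.
Proof.
move=> FF phiG fg; rewrite /limf_einf -fin_num_oppeD// leeN2.
apply: limf_esup_le_comp phiG _; apply: filterS fg => x /= gfx.
by rewrite leeNl fin_num_oppeD// oppeK.
Qed.

End Superior.

Lemma limf_einf_le_esup (T : choiceType) (X : filteredType T) (f : X -> \bar R)
    (F : set_system X) : ProperFilter F -> limf_einf f F <= limf_esup f F.
Proof.
move=> FF; rewrite limf_einfE; apply: ge_ereal_sup => _ [V FV <-].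
apply: le_ereal_inf_tmp => _ [W FW <-].
have [x [Vx Wx]] : exists x, (V `&` W) x by apply: (@filter_ex _ F); apply: filterI.
apply: (@le_trans _ _ (f x)).
  by apply: ereal_inf_lbound; exists x.
by apply: ereal_sup_ubound; exists x.
Qed.

(** Take [x] itself if it lies between [lo] and [hi], and otherwise the nearer
    end, which is then finite. *)
Lemma nearby_point (lo hi : \bar R) (x delta : R) : (0 <= delta)%R -> lo <= hi ->
  lo - delta%:E <= x%:E -> x%:E <= hi + delta%:E ->
  exists2 y : R, lo <= y%:E <= hi & (`|x - y| <= delta)%R.
Proof.
move=> d0 lohi lox xhi; have [lx|xl] := leP lo x%:E.
  have [xh|hx] := leP x%:E hi.
    by exists x; rewrite ?lx ?xh// subrr normr0.
  case: hi lohi xhi hx => [y| |] lohi xhi hx; last 2 first.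
  - by move: hx; rewrite ltNge leey.
  - by move: xhi; rewrite addNye leeNy_eq.
  exists y; first by rewrite lohi lexx.
  move: xhi hx; rewrite -EFinD lee_fin lte_fin => xhi hx.
  by rewrite ger0_norm; lra.
case: lo lohi lox xl => [y| |] lohi lox xl; last 2 first.
- by move: lox; rewrite addye// leye_eq.
- by move: xl; rewrite ltNge leNye.
exists y; first by rewrite lohi lexx.
move: lox xl; rewrite -EFinB lee_fin lte_fin => lox xl.
by rewrite ler0_norm; lra.
Qed.

(** The index sets differ: for the two averages they are the reals and
    the natural numbers, with [phi] and [psi] the maps [T |-> floor (T / h)] and
    [N |-> N h]. *)
Lemma limit_range_close (TX TY : choiceType) (X : filteredType TX)
    (Y : filteredType TY) (f : X -> R) (F : set_system X) (g : Y -> R)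
    (G : set_system Y) (phi : X -> Y) (psi : Y -> X) (delta x : R) :
  ProperFilter F -> ProperFilter G ->
  (forall V, G V -> F (phi @^-1` V)) -> (forall V, F V -> G (psi @^-1` V)) ->
  F [set x | (`|f x - g (phi x)| <= delta)%R] ->
  G [set y | (`|g y - f (psi y)| <= delta)%R] -> (0 <= delta)%R ->
  limf_einf (EFin \o f) F <= x%:E <= limf_esup (EFin \o f) F ->
  exists2 y : R, limf_einf (EFin \o g) G <= y%:E <= limf_esup (EFin \o g) G
    & (`|x - y| <= delta)%R.
Proof.
move=> FF GG phiG psiF fg gf d0 /andP[x1 x2].
apply: nearby_point => //; first exact: limf_einf_le_esup.
- apply: le_trans x1.
  apply: (limf_einf_ge_comp _ phiG); apply: filterS fg => z /=.
  by rewrite -EFinB lee_fin ler_norml => /andP[h1 h2]; lra.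
- apply: le_trans x2 _.
  apply: (limf_esup_le_comp _ phiG); apply: filterS fg => z /=.
  by rewrite -EFinD lee_fin ler_norml => /andP[h1 h2]; lra.
Qed.

Lemma edist_inf_closure_le (X Y : set R) (delta x : R) : (0 <= delta)%R ->
  (forall x, X x -> exists2 y, Y y & (`|x - y| <= delta)%R) ->
  closure X x -> edist_inf (closure Y) x <= delta%:E.
Proof.
move=> d0 XY clx; apply/lee_addgt0Pr => e e0.
have [x' [Xx' xx']] := clx (ball x e) (nbhsx_ballx x e e0).
have [y Yy x'y] := XY x' Xx'.
apply: (@le_trans _ _ (edist (x, y))).
  by apply: ereal_inf_lbound; exists y => //; exact: subset_closure.
rewrite -EFinD; apply: ereal_inf_lbound; exists (delta + e)%R => //=.
split; first by rewrite ltr_wpDl.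
move: xx'; rewrite /ball/= => xx'.
by have := ler_distD x' x y; lra.
Qed.

Lemma hausdorff_closure_le (X Y : set R) (delta : R) : (0 <= delta)%R ->
  (forall x, X x -> exists2 y, Y y & (`|x - y| <= delta)%R) ->
  (forall y, Y y -> exists2 x, X x & (`|y - x| <= delta)%R) ->
  hausdorff_dist (closure X) (closure Y) <= delta%:E.
Proof.
move=> d0 XY YX; rewrite /hausdorff_dist ge_max; apply/andP; split.
  by apply: ge_ereal_sup => _ [x clx <-]; exact: edist_inf_closure_le clx.
by apply: ge_ereal_sup => _ [x clx <-]; exact: edist_inf_closure_le clx.
Qed.

Lemma truncn_div_cvg (h : R) : (0 < h)%R -> forall V, (\oo : set_system nat) V ->
  pinfty_nbhs R [set T | V (Num.truncn (T / h))].
Proof.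
move=> h0 V [N _ NV]; exists (N%:R * h)%R; split; first exact: num_real.
move=> T NT; apply: NV => /=.
have T0 : (0 <= T / h)%R.
  by rewrite divr_ge0// ltW// (le_lt_trans _ NT)// mulr_ge0// ltW.
have /andP[_] := truncn_itv T0; rewrite -ltnS -(ltr_nat R).
by apply: le_lt_trans; rewrite ler_pdivlMr// ltW.
Qed.

Lemma natmul_cvg (h : R) : (0 < h)%R -> forall V, pinfty_nbhs R V ->
  (\oo : set_system nat) [set N | V (N%:R * h)%R].
Proof.
move=> h0 V [M [_ MV]]; exists (Num.truncn (`|M| / h)).+1 => // N /= NM.
apply: MV; apply: (le_lt_trans (ler_norm M)); rewrite -ltr_pdivrMr//.
have /andP[_ h1] := truncn_itv (divr_ge0 (normr_ge0 M) (ltW h0)).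
by apply: (lt_le_trans h1); rewrite ler_nat.
Qed.

End LimitRanges.

Theorem theorem4p6 (R : realType) (s d : nat) (hs : (1 <= s <= d)%N)
    (A : R -> 'M[R]_d) (hA : C1b A)
    (Phi : R -> R -> 'M[R]_d) (hPhi : solution_operator A Phi) :
  exists C h0 : R, [/\ 0 < C, 0 < h0 &
    forall h : R, 0 < h -> h <= h0 ->
      (hausdorff_dist (Sigma_step s Phi h) (Sigma_cont s A Phi)
         <= (C * h)%:E)%E].
Proof.
have [L [L1 AL AL']] := C1b_bounds hA.
have L0 : 0 < L := lt_le_trans ltr01 L1.
have s0 : (0 < s)%N by case/andP: hs.
have C0 : 0 < 57 * L ^+ 2 + 1.
  by rewrite ltr_wpDl// mulr_ge0// exprn_ge0// ltW.
exists (57 * L ^+ 2 + 1), (8 * L)^-1; split=> //; first by rewrite invr_gt0 mulr_gt0.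
move=> h h0; rewrite -[(8 * L)^-1]div1r ler_pdivlMr ?mulr_gt0// => hL.
have delta0 : 0 <= (57 * L ^+ 2 + 1) * h by rewrite mulr_ge0 ?(ltW C0) ?(ltW h0).
have step V : \dim V = s -> (\oo : set_system nat)
    [set N | `|alpha_step s Phi h N V - alpha_cont A Phi (N%:R * h) V|
              <= (57 * L ^+ 2 + 1) * h].
  move=> dV; exists 1%N => // N /= N1.
  apply: le_trans (alpha_step_cont hPhi L1 AL AL' s0 dV h0 hL N1) _.
  by rewrite ler_wpM2r ?(ltW h0)// lerDl.
have cont V : \dim V = s -> pinfty_nbhs R
    [set T | `|alpha_cont A Phi T V - alpha_step s Phi h (Num.truncn (T / h)) V|
              <= (57 * L ^+ 2 + 1) * h].
  move=> dV; exists (Num.max h (2 * L)); split; first exact: num_real.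
  move=> T; rewrite gt_max => /andP[/ltW hT /ltW LT] /=.
  exact: (alpha_step_truncn hPhi L1 AL AL' s0 dV h0 hL).
apply: hausdorff_closure_le => // x [V dV [x1 x2]].
  have x12 : (limf_einf (EFin \o (alpha_step s Phi h ^~ V)) \oo <= x%:E <=
      limf_esup (EFin \o (alpha_step s Phi h ^~ V)) \oo)%E.
    by apply/andP; split.
  have [y /andP[y1 y2] xy] := limit_range_close _ _ (natmul_cvg h0)
     (truncn_div_cvg h0) (step V dV) (cont V dV) delta0 x12.
  by exists y => //; exists V => //; split.
have x12 : (limf_einf (EFin \o (alpha_cont A Phi ^~ V)) (pinfty_nbhs R) <= x%:E
      <= limf_esup (EFin \o (alpha_cont A Phi ^~ V)) (pinfty_nbhs R))%E.
  by apply/andP; split.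
have [y /andP[y1 y2] xy] := limit_range_close _ _ (truncn_div_cvg h0)
     (natmul_cvg h0) (cont V dV) (step V dV) delta0 x12.
by exists y => //; exists V => //; split.
Qed.
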